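(* Let $L\in\frac12\mathbb Z_{\ge0}$ and $i,j\in\{0,1\}$ with $j\equiv2L\bmod2$. Then $${\rm ch}_{q,z}\Bigl(\bigoplus_{N\ge0,\ N\equiv i+j\bmod2}\widehat W_{N,L}\Bigr)=\chi_i(q^{-1},z)\,\chi_j(q,z;L).$$
   Context: For $N\ge 0$ and $0\le l\le N$, let $C_{N,l}$ be the space of skew-symmetric polynomials $P(X_1,\dots,X_l|z_1,\dots,z_N)$ in $X_1,\dots,X_l$ of degree $\le N-1$ in each $X_a$, with coefficients that are symmetric polynomials (over $\mathbb C$) in $z_1,\dots,z_N$. $P\in C_{N,l}$ is minimal if $P=0$ whenever $X_l^{-1}=z_{N-1}=-z_N$ (no condition if $l=0$ or $N<2$). $W_{N,l}$ is the subspace of minimal elements and $W_N=\bigoplus_{l=0}^NW_{N,l}$. For $L\in\frac12\mathbb Z_{\ge0}$, $\widehat W_{N,L}:=\bigl(\prod_{j=1}^Nz_j\bigr)^{-L}W_N$. Bi-grading: with $\deg_0X_a=-1$, $\deg_0z_j=1$, set $\deg P=\frac{N^2}4+\deg_0P$; an element with $l$ variables $X_a$ has weight $N-2l$; the bi-grading is $(d,m)=(-\deg,\text{weight})$. For a bi-graded space $V=\bigoplus V_{d,m}$, ${\rm ch}_{q,z}V=\sum_{d,m}q^dz^m\dim V_{d,m}$. Let $(z)_n=\prod_{k=0}^{n-1}(1-q^kz)$, so $(q)_n=\prod_{k=1}^n(1-q^k)$, $(q)_\infty=\prod_{k\ge1}(1-q^k)$; ${m\brack n}=\frac{(q)_m}{(q)_n(q)_{m-n}}$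 if $m\ge n\ge0$ and $0$ otherwise. Then $$\chi_i(q,z)=\frac1{(q)_\infty}\sum_{m\in2\mathbb Z+i}q^{m^2/4}z^m,\qquad \chi_j(q,z;L)=\sum_{m\in2\mathbb Z+j}{2L\brack L+\frac m2}q^{m^2/4}z^m\quad(j\equiv2L\bmod2).$$ *)

(* Defs.v *)
From HB Require Import structures.
From mathcomp Require Import all_boot all_order all_fingroup all_algebra.
From mathcomp Require Export boolp classical_sets fsbigop reals.
From mathcomp Require Export complex.
From mathcomp Require Export freeg mpoly.
Set Implicit Arguments.
Unset Strict Implicit.
Unset Printing Implicit Defensive.
Import Order.TTheory GRing.Theory Num.Theory.
Local Open Scope classical_set_scope.
Local Open Scope ring_scope.

Section Spaces.
Variable C : fieldType.

Definition skew_symmetric (A : comNzRingType) (n : nat) (P : {mpoly A[n]}) :=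
  forall s : 'S_n, msym s P = (-1) ^+ odd_perm s *: P.

(* A polynomial P(X_1,...,X_l | z_1,...,z_N) is a polynomial in the X_a with
   coefficients in C[z_1,...,z_N].  Only l <= N is used below, so for N = 0
   there is no X_a and the degree bound is void. *)
Definition Cspace (N l : nat) : set {mpoly {mpoly C[N]}[l]} :=
  [set P | [/\ skew_symmetric P,
               forall (m : 'X_{1..l}) (a : 'I_l), m \in msupp P -> (m a < N)%N
             & forall m : 'X_{1..l}, P@_m \is symmetric]].

(* x a, z b, z c are X_l, z_{N-1}, z_N; no such a, b, c exist when l = 0 or
   N < 2.  As 0^-1 = 0, the condition x a != 0 has to be explicit. *)
Definition minimal (N l : nat) (P : {mpoly {mpoly C[N]}[l]}) :=
  forall (x : 'I_l -> C) (z : 'I_N -> C) (a : 'I_l) (b c : 'I_N),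
    a.+1 = l -> b.+2 = N -> c.+1 = N ->
    x a != 0 -> (x a)^-1 = z b -> z b = - z c ->
    P.@[fun k => (x k)%:MP].@[z] = 0.

Definition W (N l : nat) : set {mpoly {mpoly C[N]}[l]} :=
  [set P | Cspace P /\ minimal P].

(* (a, c) with size a = l and size c = N stands for the monomial
   X_1^a_1 ... X_l^a_l z_1^c_1 ... z_N^c_N with rational powers of the z_j.
   Monomials with different (N, l) are distinct keys, so that the free module
   on these keys contains the direct sum over all (N, l). *)
Definition monomial : choiceType := (seq nat * seq rat)%type.

Definition hatmonomial (N l : nat) (L : rat)
    (a : 'X_{1..l}) (b : 'X_{1..N}) : monomial :=
  ([seq a k | k <- enum 'I_l], [seq (b k)%:R - L | k <- enum 'I_N]).

(* (z_1 ... z_N)^(-L) P *)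
Definition twist (N l : nat) (L : rat) (P : {mpoly {mpoly C[N]}[l]}) :
    {freeg monomial / C} :=
  \sum_(a <- msupp P) \sum_(b <- msupp P@_a) << P@_a@_b *g hatmonomial L a b >>.

Definition hatW (N l : nat) (L : rat) : set {freeg monomial / C} :=
  [set twist L P | P in @W N l].

(* The direct sum over all N = p mod 2 of the hat W_{N,L}. *)
Definition hatW_sum (L : rat) (p : nat) : set {freeg monomial / C} :=
  [set F | exists (M : nat) (G : nat -> nat -> {freeg monomial / C}),
     (forall N l : nat, N = p %[mod 2] -> (l <= N)%N -> hatW N l L (G N l)) /\
     F = \sum_(N < M | N == p %[mod 2]) \sum_(l < N.+1) G N l].

Definition bidegree (k : monomial) : rat * int :=
  let N := size k.2 in
  let l := size k.1 in
  let deg0 : rat := \sum_(c <- k.2) c - \sum_(a <- k.1) a%:R in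
  (- (N%:R ^+ 2 / 4 + deg0), N%:Z - 2 * l%:Z).

Definition piece (V : set {freeg monomial / C}) (d : rat) (m : int) :
    set {freeg monomial / C} :=
  [set F | V F /\ forall k, coeff k F != 0 -> bidegree k = (d, m)].

Definition bigraded (V : set {freeg monomial / C}) :=
  forall F, V F ->
    exists s : seq {freeg monomial / C}, F = \sum_(G <- s) G /\
      forall G, G \in s -> exists d m, piece V d m G.

Definition has_dim (U : lmodType C) (V : set U) (n : nat) :=
  exists e : 'I_n -> U,
    (forall c : 'I_n -> C, \sum_(k < n) c k *: e k = 0 -> forall k, c k = 0) /\
    (forall v, V v <-> exists c : 'I_n -> C, v = \sum_(k < n) c k *: e k).

(* The formal series \sum_{d,m} f d m q^d z^m. *)
Definition qz_series := rat -> int -> rat.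

(* ch_{q,z} V is defined (V is the sum of its homogeneous parts, all of them
   finite-dimensional) and equals f. *)
Definition has_character (V : set {freeg monomial / C}) (f : qz_series) :=
  bigraded V /\
  forall (d : rat) (m : int), exists n : nat,
    has_dim (piece V d m) n /\ f d m = n%:R.

End Spaces.

Arguments hatW_sum : clear implicits.

(* Meaningful when, for all d and m, only finitely many terms are nonzero. *)
Definition qz_mul (f g : qz_series) : qz_series := fun d m =>
  \sum_(p \in [set: (rat * int)%type]) (f (d - p.1) (m - p.2) * g p.1 p.2).

(* q |-> q^-1 *)
Definition qz_invq (f : qz_series) : qz_series := fun d m => f (- d) m.

(* (q)_n, as a polynomial in q = 'X *)
Definition qpoch (n : nat) : {poly rat} := \prod_(1 <= k < n.+1) (1 - 'X^k).

(* The quotient is exact. *)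
Definition qbinom (m n : int) : {poly rat} :=
  if 0 <= n <= m then qpoch `|m| %/ (qpoch `|n| * qpoch `|m - n|) else 0.

(* The coefficient of q^n in 1/(q)_oo: modulo q^(n+1), (q)_oo equals (q)_n,
   and 1/(q)_n is the geometric series in 1 - (q)_n, which is divisible by q. *)
Definition inv_qpoch_inf (n : nat) : rat :=
  (\sum_(r < n.+1) (1 - qpoch n) ^+ r)`_n.

(* The coefficient of q^e in \sum_n (u n) q^n, for a rational exponent e. *)
Definition qcoef (u : nat -> rat) (e : rat) : rat :=
  if e \is a Num.nat then u (Num.truncn e) else 0.

Definition chi (i : nat) : qz_series := fun d m =>
  if (m == i %[mod 2])%Z then qcoef inv_qpoch_inf (d - m%:~R ^+ 2 / 4) else 0.

(* When m = j = 2L mod 2, the numbers 2L and L + m/2 are integers. *)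
Definition chiL (j : nat) (L : rat) : qz_series := fun d m =>
  if (m == j %[mod 2])%Z
  then qcoef (fun n => (qbinom (Num.floor (2 * L)) (Num.floor (L + m%:~R / 2)))`_n)
         (d - m%:~R ^+ 2 / 4)
  else 0.

(* Main.v *)
Require Import Defs.
From HB Require Import structures.
From mathcomp Require Import all_boot all_order all_fingroup all_algebra.
From mathcomp Require Import ring lra zify freeg mpoly.
Set Implicit Arguments.
Unset Strict Implicit.
Unset Printing Implicit Defensive.
Import Order.TTheory GRing.Theory Num.Theory.
Local Open Scope ring_scope.

(** Write N = l + r.  A skew-symmetric P of degree < N in each X_a is determined
    by its values at X_a = 1/z_a (a <= l): the other points of the grid
    {1/z_1, ..., 1/z_N}^l follow from the symmetry in z and the skew-symmetry in
    X.  Minimality and skew-symmetry make these values, multiplied by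
    (z_1 ... z_l)^(N-1), divisible by
      V = prod_(a < a' <= l) (z_a'^2 - z_a^2) * prod_(a <= l < b) (z_a + z_b),
    and the quotient h is any polynomial symmetric in z_1..z_l and in
    z_(l+1)..z_N.  Conversely, h is realised, up to a constant factor, by
      P = Delta(z)^-1 sum_(w in S_N) sgn(w) w(h V det A),
    where A has rows (X_a^(N-1-k))_k for a <= l and (z_b^k)_k for b > l.  As P
    and h have the same degree, W_(N,l) has a basis indexed by pairs of
    partitions with at most l and r parts, and its Hilbert series is
    1 / ((q)_l (q)_r).  The theorem becomes the identity
      sum_b q^(b(b+m-M)) / ((q)_b (q)_(b+m))
        = 1/(q)_oo sum_s q^(ms) [M, s]_(1/q),   M = 2L,
    both sides of which satisfy F_(M+1)(m) = q^(m-M) F_M(m+1) + F_M(m); the case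
    M = 0 is the Durfee rectangle identity. *)

(** * Polynomials and their values *)

(** The factor (z_1 ... z_l)^(N-1) clears the denominators of P at X_a = 1/z_a. It has degree
    l(N-1), and so has V, since l(l-1) + lr = l(N-1); with X_a of degree -1 this is why h keeps the
    degree of P. In the converse, put X_a = 1/z_a. The row of X_a in A becomes proportional to a row
    of z_a, so det A vanishes unless w preserves the two blocks of indices. In the surviving terms
    det A is, up to the same factor (z_1 ... z_l)^(N-1), the Vandermonde determinant Delta, which
    cancels the denominator and leaves V times a sum over S_l x S_r. The values at 1/z_a exist only
    for nonzero z_k and determine P only for distinct z_k. Polynomial identities are therefore
    checked off the zeros of Delta and of the z_k, and extended by density. In the final identity b
    is r, the number of parts allowed in the second partition, and m is l - r, that is, minus the
    weight: N = 2r + m gives N^2/4 - NL = r(r + m - M) + m^2/4 - mM/2. *)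

Lemma det_Vandermonde_neq0 (F : idomainType) n (c : 'I_n -> F) :
  injective c -> \det (Vandermonde n (\row_i c i)) != 0.
Proof.
move=> c_inj; rewrite det_Vandermonde; apply/prodf_neq0 => i _.
apply/prodf_neq0 => j lt_ij; rewrite !mxE subr_eq0.
by apply: contraTneq lt_ij => /c_inj ->; rewrite ltnn.
Qed.

(* Contracting the values on the grid with the adjugate of the Vandermonde
   matrix in each variable isolates a single coefficient. *)
Lemma mpoly_grid_eq0 (F : idomainType) n l (c : 'I_n -> F) (p : {mpoly F[l]}) :
    injective c ->
    (forall (m : 'X_{1..l}) a, m \in msupp p -> (m a < n)%N) ->
    (forall f : {ffun 'I_l -> 'I_n}, p.@[fun a => c (f a)] = 0) ->
  p = 0.
Proof.
move=> c_inj degp p0; set V := Vandermonde n (\row_i c i).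
have detV : \det V != 0 by exact: det_Vandermonde_neq0.
apply/eqP; rewrite -msupp_eq0; case def_p: (msupp p) => [//|m s].
have mp : m \in msupp p by rewrite def_p mem_head.
pose k a := Ordinal (degp m a mp).
have : \sum_(f : {ffun 'I_l -> 'I_n})
    p.@[fun a => c (f a)] * \prod_a \adj V (f a) (k a) = p@_m * \det V ^+ l.
  under eq_bigr do rewrite mevalE mulr_suml.
  rewrite exchange_big /= (big_rem m) //= [X in _ + X]big1_seq ?addr0; last first.
    move=> m' /= ; rewrite mem_rem_uniq ?msupp_uniq // => /andP[nm m'p].
    transitivity (p@_m' * \prod_a (V *m \adj V) (Ordinal (degp m' a m'p)) (k a)).
      under [X in _ * X]eq_bigr do rewrite mxE.
      rewrite bigA_distr_bigA /= mulr_sumr; apply: eq_bigr => f _.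
      rewrite -mulrA -big_split /=; congr (_ * _).
      by apply: eq_bigr => a _; rewrite !mxE.
    have [a ne_a] : exists a, m' a != m a.
      apply/existsP; apply: contraR nm; rewrite negb_exists => /forallP eqm.
      by apply/eqP/mnmP => a; apply/eqP; move: (eqm a); rewrite negbK.
    rewrite (bigD1 a) //= mul_mx_adj mxE.
    by rewrite -(inj_eq val_inj) /= (negPf ne_a) mulr0n mul0r mulr0.
  transitivity (p@_m * \prod_a (V *m \adj V) (k a) (k a)).
    under [X in _ * X]eq_bigr do rewrite mxE.
    rewrite bigA_distr_bigA /= mulr_sumr; apply: eq_bigr => f _.
    rewrite -mulrA -big_split /=; congr (_ * _).
    by apply: eq_bigr => a _; rewrite !mxE.
  congr (_ * _); under eq_bigr do rewrite mul_mx_adj mxE eqxx mulr1n.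
  by rewrite prodr_const card_ord.
rewrite big1 => [/esym/eqP|f _]; last by rewrite p0 mul0r.
by rewrite mulf_eq0 expf_eq0 (negPf detV) andbF orbF mcoeff_eq0 mp.
Qed.

Lemma leq_mdeg n (m : 'X_{1..n}) (i : 'I_n) : (m i <= mdeg m)%N.
Proof. by rewrite mdegE (bigD1 i) //= leq_addr. Qed.

Lemma meval_msym (R : comNzRingType) n (s : 'S_n) (p : {mpoly R[n]}) v :
  (msym s p).@[v] = p.@[fun i => v (s i)].
Proof.
elim/mpolyind: p => [|c m p _ _ IH]; first by rewrite msym0 !meval0.
rewrite msymD msymZ msymX !mevalD !mevalZ IH !mevalX; congr (_ * _ + _).
rewrite (reindex_perm s) /=; apply: eq_bigr => i _; congr (_ ^+ _).
by rewrite mnmE permK.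
Qed.

Section Points.
Variable C : numFieldType.

Lemma mpoly_eq0_meval n (p : {mpoly C[n]}) : (forall v, p.@[v] = 0) -> p = 0.
Proof.
move=> p0; apply: (@mpoly_grid_eq0 _ (msize p) _ (fun i : 'I__ => i%:R)) => //.
- by move=> i j /eqP; rewrite eqr_nat => /eqP/val_inj.
- by move=> m a /msize_mdeg_lt; apply: leq_ltn_trans; apply: leq_mdeg.
Qed.

Lemma mpoly_eq_meval n (p q : {mpoly C[n]}) :
  (forall v, p.@[v] = q.@[v]) -> p = q.
Proof.
by move=> pq; apply/eqP; rewrite -subr_eq0; apply/eqP/mpoly_eq0_meval => v;
  rewrite mevalB pq subrr.
Qed.

(** D (p - q) vanishes at every point and D is not a zero divisor. In use, D collects the degenerate
    points to be avoided. *)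
Lemma mpoly_eq_dense n (D p q : {mpoly C[n]}) :
  D != 0 -> (forall v, D.@[v] != 0 -> p.@[v] = q.@[v]) -> p = q.
Proof.
move=> D0 pq; apply: (mulfI D0); apply: mpoly_eq_meval => v; rewrite !mevalM.
by have [->|/pq->//] := eqVneq D.@[v] 0; rewrite !mul0r.
Qed.

Lemma mpoly_neq0_meval n (p : {mpoly C[n]}) v : p.@[v] != 0 -> p != 0.
Proof. by apply: contraNneq => ->; rewrite meval0. Qed.

Lemma meval_comp_mktuple n k (f : 'I_n -> {mpoly C[k]}) p v :
  (p \mPo [tuple f i | i < n]).@[v] = p.@[fun i => (f i).@[v]].
Proof. by rewrite comp_mpoly_meval; apply: meval_eq => i; rewrite tnth_mktuple. Qed.

End Points.

(** * Evaluation in both sets of variables *)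

Section TwoLevels.
Variables (C : numFieldType) (N l : nat).
Implicit Types (P Q : {mpoly {mpoly C[N]}[l]}) (x : 'I_l -> C) (z : 'I_N -> C).

(** This is the evaluation occurring in [minimal], packaged as a ring morphism. *)
Definition ev2 x z : {mpoly {mpoly C[N]}[l]} -> C :=
  meval z \o meval (fun k => (x k)%:MP).

HB.instance Definition _ x z := GRing.RMorphism.copy (ev2 x z)
  (meval z \o meval (fun k => (x k)%:MP)).

Lemma ev2Z x z c P : ev2 x z (c *: P) = c.@[z] * ev2 x z P.
Proof. by rewrite /ev2 /= mevalZ mevalM. Qed.

Lemma ev2X x z i : ev2 x z 'X_i = x i.
Proof. by rewrite /ev2 /= mevalXU mevalC. Qed.

Lemma ev2C x z c : ev2 x z c%:MP = c.@[z].
Proof. by rewrite /ev2 /= mevalC. Qed.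

Lemma ev2_map x z P : ev2 x z P = (map_mpoly (meval z) P).@[x].
Proof.
elim/mpolyind: P => [|c m P _ _ IH]; first by rewrite !rmorph0.
rewrite !rmorphD /= IH; congr (_ + _).
rewrite ev2Z map_mpolyZ map_mpolyX mevalZ mevalX /ev2 /= mevalX rmorph_prod /=.
by congr (_ * _); apply: eq_bigr => i _; rewrite rmorphXn /= mevalC.
Qed.

Lemma ev2E x z P :
  ev2 x z P = \sum_(m <- msupp P) (P@_m).@[z] * \prod_i x i ^+ m i.
Proof.
rewrite /ev2 /= [P.@[_]]mevalE raddf_sum /=; apply: eq_bigr => m _.
rewrite rmorphM rmorph_prod /=; congr (_ * _); apply: eq_bigr => i _.
by rewrite rmorphXn /= mevalC.
Qed.

(** For fixed z and z', both sides are polynomials in x over an infinite field. This transfers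
    symmetry in z from the values of P to its coefficients. *)
Lemma ev2_coeff z z' c P P' :
    (forall x, ev2 x z P = c * ev2 x z' P') ->
  forall m, (P@_m).@[z] = c * (P'@_m).@[z'].
Proof.
move=> eqPP' m; rewrite -!mcoeff_map_mpoly -mcoeffZ; congr mcoeff.
by apply: mpoly_eq_meval => x; rewrite mevalZ -!ev2_map.
Qed.

Lemma ev2_dense (D : {mpoly C[N]}) P Q : D != 0 ->
  (forall x z, D.@[z] != 0 -> ev2 x z P = ev2 x z Q) -> P = Q.
Proof.
move=> D0 eqPQ; apply/mpolyP => m; apply: mpoly_eq_dense D0 _ => z Dz.
by rewrite (@ev2_coeff z z 1 P Q) ?mul1r // => x; rewrite eqPQ ?mul1r.
Qed.

Lemma ev2_msym (s : 'S_l) x z P : ev2 x z (msym s P) = ev2 (x \o s) z P.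
Proof. by rewrite /ev2 /= meval_msym. Qed.

Lemma eq_ev2 x x' z z' P : x =1 x' -> z =1 z' -> ev2 x z P = ev2 x' z' P.
Proof.
move=> ex ez; rewrite /ev2 /= (meval_eq _ ez); congr meval.
by apply: meval_eq => i; rewrite ex.
Qed.

Lemma ev2_skew (s : 'S_l) x z P : skew_symmetric P ->
  ev2 (x \o s) z P = (-1) ^+ odd_perm s * ev2 x z P.
Proof.
by move=> /(_ s) sP; rewrite -ev2_msym sP ev2Z rmorphXn rmorphN rmorph1.
Qed.

Lemma ev2_sym (s : 'S_N) x z P : (forall m, P@_m \is symmetric) ->
  ev2 x (z \o s) P = ev2 x z P.
Proof.
move=> symP; rewrite !ev2E; apply: eq_bigr => m _; congr (_ * _).
by rewrite -meval_msym (issymP _ (symP m)).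
Qed.

Lemma skew_ev2_eq0 x z P i j : skew_symmetric P -> i != j -> x i = x j ->
  ev2 x z P = 0.
Proof.
move=> skP ne_ij xij; have := ev2_skew (tperm i j) x z skP.
rewrite odd_tperm ne_ij expr1 mulN1r (@eq_ev2 _ x z z) // => [/eqP|k] /=.
  by rewrite -addr_eq0 -mulr2n mulrn_eq0 => /eqP.
by case: tpermP => // ->.
Qed.

End TwoLevels.

(** * Divisibility by products of linear forms *)

Section LinearForms.
Variables (C : numFieldType) (n : nat).
Implicit Types (p q : {mpoly C[n]}) (t : 'I_n * 'I_n * bool).

(** The boolean selects z_j - z_i or z_j + z_i, so that one divisibility lemma serves both Delta and
    V. *)
Definition lin t : {mpoly C[n]} := 'X_t.1.2 - (-1) ^+ t.2 *: 'X_t.1.1.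

Definition elim_lin t p :=
  p \mPo [tuple if k == t.1.2 then (-1) ^+ t.2 *: 'X_t.1.1 else 'X_k | k < n].

Lemma meval_lin t v : (lin t).@[v] = v t.1.2 - (-1) ^+ t.2 * v t.1.1.
Proof. by rewrite /lin mevalB mevalZ !mevalXU. Qed.

Lemma meval_elim_lin t p v : (elim_lin t p).@[v] =
  p.@[fun k => if k == t.1.2 then (-1) ^+ t.2 * v t.1.1 else v k].
Proof.
rewrite meval_comp_mktuple; apply: meval_eq => k; case: eqP => _.
  by rewrite mevalZ mevalXU.
by rewrite mevalXU.
Qed.

Lemma elim_linM t p q : elim_lin t (p * q) = elim_lin t p * elim_lin t q.
Proof. exact: rmorphM. Qed.

(** [elim_lin t] restricts to the hyperplane where [lin t] vanishes. Congruence to the restriction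
    modulo [lin t] is stable under sums and products and holds for the variables. *)
Lemma lin_dvd_sub t p : exists q, p - elim_lin t p = lin t * q.
Proof.
pose Q p := exists q, p - elim_lin t p = lin t * q.
have QM p1 p2 : Q p1 -> Q p2 -> Q (p1 * p2).
  case=> q1 e1 [q2 e2]; exists (q1 * p2 + elim_lin t p1 * q2).
  by rewrite elim_linM mulrDr mulrA -e1 mulrCA -e2; ring.
have QX k : Q 'X_k.
  rewrite /Q /elim_lin comp_mpolyXU -tnth_nth tnth_mktuple; case: eqP => [->|_].
    by exists 1; rewrite mulr1.
  by exists 0; rewrite mulr0 subrr.
have Q1 : Q 1 by exists 0; rewrite /elim_lin rmorph1 subrr mulr0.
change (Q p); elim/mpolyind: p => [|c m p _ _ [q eq]].
  by exists 0; rewrite /elim_lin rmorph0 subrr mulr0.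
have [q' eq'] : Q 'X_[m].
  rewrite mpolyXE_id; apply: big_ind => // i _.
  by elim: (m i) => [|k IH]; rewrite ?expr0 // exprS; apply: QM.
exists (c *: q' + q); rewrite /elim_lin comp_mpolyD comp_mpolyZ -!/(elim_lin _ _).
by rewrite mulrDr -scalerAr -eq' -eq scalerBr; ring.
Qed.

(** The forms are divided out one at a time. The quotient by [lin t] still vanishes on every other
    hyperplane, because [lin t] is not identically zero there. *)
Lemma dvd_prod_lin (s : seq ('I_n * 'I_n * bool)) p :
    uniq s -> {in s, forall t, (t.1.1 < t.1.2)%N} ->
    {in s, forall t, elim_lin t p = 0} ->
  exists q, p = (\prod_(t <- s) lin t) * q.
Proof.
elim: s p => [|t s IH] p /=; first by exists p; rewrite big_nil mul1r.
case/andP=> ts us lts p0; have [q eq] := lin_dvd_sub t p.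
rewrite p0 ?mem_head // subr0 in eq.
have [||t' t's|q' eq'] := IH q => //.
- by move=> t' t's; apply: lts; rewrite inE t's orbT.
- have : elim_lin t' (lin t) * elim_lin t' q = 0.
    by rewrite -elim_linM -eq p0 // inE t's orbT.
  move/eqP; rewrite mulf_eq0 => /orP[|/eqP//]; apply: contraTeq => _.
  (* At this point the coordinates are positive and distinct. After the restriction along t' only
     the coordinates of t' agree in absolute value, so a zero of [lin t] forces the index pairs,
     then the signs, to coincide. *)
  apply: (@mpoly_neq0_meval _ _ _ (fun k => (val k).+1%:R)).
  rewrite meval_elim_lin meval_lin.
  have lt' : (t'.1.1 < t'.1.2)%N by apply: lts; rewrite inE t's orbT.
  have lt : (t.1.1 < t.1.2)%N by apply: lts; rewrite mem_head.
  have : t != t' by apply: contraNneq ts => ->.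
  case: t t' lt lt' {ts lts p0 eq t's} => [[i j] b] [[i' j'] b'] /= lt lt'.
  rewrite subr_eq0; apply: contra => /eqP eqv; have nv := congr1 Num.norm eqv; move: nv eqv.
  rewrite normrM normr_sign mul1r.
  have [ej|_] := eqVneq j j'; have [ei|_] := eqVneq i j'.
  - by move: lt; rewrite ei ej ltnn.
  - rewrite normrM normr_sign mul1r !normr_nat => /eqP.
    rewrite eqr_nat eqSS => /eqP/val_inj ei' /eqP; rewrite ei' ej.
    rewrite (can_eq (mulfK _)) ?pnatr_eq0 // (inj_eq (@signr_inj _)).
    by move=> /eqP->.
  - rewrite normrM normr_sign mul1r !normr_nat => /eqP; rewrite eqr_nat eqSS.
    by move=> /eqP eji; move: lt lt'; rewrite ei eji => lt1 /(ltn_trans lt1); rewrite ltnn.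
  - rewrite !normr_nat => /eqP; rewrite eqr_nat eqSS => /eqP eji.
    by move: lt; rewrite eji ltnn.
by exists q'; rewrite big_cons eq eq' mulrA.
Qed.

End LinearForms.

(** * The interpolation matrix *)

Section BlockPerm.
Variables l r : nat.

(** These are the elements of the Young subgroup S_l x S_r of S_N. *)
Definition bperm_fun (u : 'S_l) (v : 'S_r) (k : 'I_(l + r)) : 'I_(l + r) :=
  match split k with inl a => lshift r (u a) | inr b => rshift l (v b) end.

Lemma bperm_fun_inj u v : injective (bperm_fun u v).
Proof.
move=> k k'; rewrite -[k]splitK -[k']splitK.
case: (split k) => a; case: (split k') => b; rewrite /bperm_fun !unsplitK /=.
- by move=> /lshift_inj/perm_inj->.
- by move/eqP; rewrite eq_lrshift.
- by move/eqP; rewrite eq_rlshift.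
- by move=> /rshift_inj/perm_inj->.
Qed.

Definition bperm u v : 'S_(l + r) := perm (@bperm_fun_inj u v).

Lemma bpermL u v a : bperm u v (lshift r a) = lshift r (u a).
Proof. by rewrite permE /bperm_fun (unsplitK (inl a)). Qed.

Lemma bpermR u v b : bperm u v (rshift l b) = rshift l (v b).
Proof. by rewrite permE /bperm_fun (unsplitK (inr b)). Qed.

Lemma bperm_inj : injective (fun uv => bperm uv.1 uv.2).
Proof.
move=> [u v] [u' v'] /= /permP e; congr (_, _); apply/permP => i.
- by have := e (lshift r i); rewrite !bpermL => /lshift_inj.
- by have := e (rshift l i); rewrite !bpermR => /rshift_inj.
Qed.

Lemma sign_bperm (R : comNzRingType) u v :
  (-1) ^+ odd_perm (bperm u v) = (-1) ^+ odd_perm u * (-1) ^+ odd_perm v :> R.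
Proof.
rewrite -!det_perm.
suff -> : perm_mx (bperm u v) = block_mx (perm_mx u) 0 0 (perm_mx v) :> 'M[R]_(l + r).
  by rewrite det_ublock.
apply/matrixP => k k'; rewrite -[k]splitK -[k']splitK.
case: (split k) => a; case: (split k') => b;
  rewrite ?block_mxEul ?block_mxEur ?block_mxEdl ?block_mxEdr !mxE.
- by rewrite bpermL (inj_eq (@lshift_inj _ _)).
- by rewrite bpermL eq_lrshift.
- by rewrite bpermR eq_rlshift.
- by rewrite bpermR (inj_eq (@rshift_inj _ _)).
Qed.

(** If w maps the second block into itself, it permutes it by finiteness, and hence permutes the
    first block too. The second alternative is the case in which det A will have proportional
    rows. *)
Lemma bpermP (w : 'S_(l + r)) :
  (exists uv, w = bperm uv.1 uv.2) \/
  (exists a b, w (rshift l b) = lshift r a).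
Proof.
have [/existsP[b /existsP[a /eqP e]]|] :=
    boolP [exists b, [exists a, w (rshift l b) == lshift r a]].
  by right; exists a, b.
rewrite negb_exists => /forallP wJ; left.
have {}wJ b : exists b', w (rshift l b) == rshift l b'.
  case: (split_ordP (w (rshift l b))) => [a e|b' ->]; last by exists b'.
  by have /existsP[] := wJ b; exists a; rewrite e.
pose v b := xchoose (wJ b).
have vP b : w (rshift l b) = rshift l (v b) by apply/eqP/(xchooseP (wJ b)).
have v_inj : injective v.
  by move=> b b' e; apply: (@rshift_inj l); apply: (@perm_inj _ w); rewrite !vP e.
have wI a : exists a', w (lshift r a) == lshift r a'.
  case: (split_ordP (w (lshift r a))) => [a' ->|b' e]; first by exists a'.
  have [v' _ v'K] := injF_bij v_inj.
  move: e; rewrite -[b']v'K -vP => /perm_inj/eqP.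
  by rewrite eq_lrshift.
pose u a := xchoose (wI a).
have uP a : w (lshift r a) = lshift r (u a) by apply/eqP/(xchooseP (wI a)).
have u_inj : injective u.
  by move=> a a' e; apply: (@lshift_inj _ r); apply: (@perm_inj _ w); rewrite !uP e.
exists (perm u_inj, perm v_inj); apply/permP => k; rewrite -[k]splitK.
by case: (split k) => a /=; rewrite ?bpermL ?bpermR ?uP ?vP permE.
Qed.

End BlockPerm.

Section InterpolationMatrix.
Variables l r : nat.

(** With the exponents reversed in the upper rows, the row of x is x^(N-1) times the row of y = 1/x,
    while the degree in each x stays below N. *)
Definition interp_mx (R : comNzRingType) (x : 'I_l -> R) (y : 'I_r -> R) :
    'M[R]_(l + r) :=
  col_mx (\matrix_(a, k) x a ^+ ((l + r).-1 - k)) (\matrix_(b, k) y b ^+ k).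

Lemma interp_mxL (R : comNzRingType) x y a k :
  @interp_mx R x y (lshift r a) k = x a ^+ ((l + r).-1 - k).
Proof. by rewrite col_mxEu mxE. Qed.

Lemma interp_mxR (R : comNzRingType) x y b k :
  @interp_mx R x y (rshift l b) k = y b ^+ k.
Proof. by rewrite col_mxEd mxE. Qed.

Definition interp_mxE := (interp_mxL, interp_mxR).

Lemma det_interp_mx_perm (R : comNzRingType) (x : 'I_l -> R) y (u : 'S_l) (v : 'S_r) :
  \det (interp_mx (x \o u) (y \o v)) =
  (-1) ^+ odd_perm u * (-1) ^+ odd_perm v * \det (interp_mx x y).
Proof.
rewrite -sign_bperm -det_perm -det_mulmx -row_permE; congr (\det _).
apply/matrixP => k k'; rewrite [RHS]mxE -[k]splitK.
by case: (split k) => a /=; rewrite ?bpermL ?bpermR !interp_mxE.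
Qed.

Lemma det_interp_mx_permL (R : comNzRingType) (x : 'I_l -> R) y (u : 'S_l) :
  \det (interp_mx (x \o u) y) = (-1) ^+ odd_perm u * \det (interp_mx x y).
Proof.
have := det_interp_mx_perm x y u 1; rewrite odd_perm1 mulr1 => <-.
by congr (\det _); apply/matrixP => k k'; rewrite -[k]splitK;
  case: (split k) => a; rewrite !interp_mxE //= perm1.
Qed.

Lemma det_interp_mx_permR (R : comNzRingType) (x : 'I_l -> R) y (v : 'S_r) :
  \det (interp_mx x (y \o v)) = (-1) ^+ odd_perm v * \det (interp_mx x y).
Proof.
have := det_interp_mx_perm x y 1 v; rewrite odd_perm1 mul1r => <-.
by congr (\det _); apply/matrixP => k k'; rewrite -[k]splitK;
  case: (split k) => a; rewrite !interp_mxE //= perm1.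
Qed.

(** Multiplying the upper rows of A(x, cy) by c^(N-1) gives the same matrix as multiplying column k
    of A(cx, y) by c^k. *)
Lemma det_interp_mx_scale (R : comNzRingType) (c : R) x y :
  c ^+ ((l + r).-1 * l) * \det (interp_mx x (fun b => c * y b)) =
  c ^+ (\sum_(k < l + r) k) * \det (interp_mx (fun a => c * x a) y).
Proof.
pose D1 := row_mx (const_mx (c ^+ (l + r).-1)) (const_mx 1) : 'rV_(l + r).
pose D2 := \row_(k < l + r) c ^+ k.
transitivity (\det (diag_mx D1 *m interp_mx x (fun b => c * y b))).
  rewrite det_mulmx det_diag big_split_ord /=; congr (_ * _).
  rewrite [X in _ = _ * X]big1 => [|b _]; last by rewrite row_mxEr mxE.
  under eq_bigr do rewrite row_mxEl mxE.
  by rewrite prodr_const card_ord mulr1 -exprM.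
transitivity (\det (interp_mx (fun a => c * x a) y *m diag_mx D2)).
  congr (\det _); apply/matrixP => k k'.
  rewrite mul_diag_mx mul_mx_diag [LHS]mxE [RHS]mxE [D2 _ _]mxE -[k]splitK.
  case: (split k) => a /=; rewrite !interp_mxE.
    rewrite row_mxEl mxE exprMn mulrAC -exprD subnK // -ltnS.
    by rewrite (ltn_predK (ltn_ord k')).
  by rewrite row_mxEr mxE mul1r exprMn mulrC.
rewrite det_mulmx det_diag mulrC; congr (_ * _).
by under eq_bigr do rewrite mxE; rewrite -expr_sum.
Qed.

Lemma det_interp_mx_eq0 (F : fieldType) (x : 'I_l -> F) (y : 'I_r -> F) a b :
  x a * y b = 1 -> \det (interp_mx x y) = 0.
Proof.
move=> xy; apply/eqP/det0P.
exists (delta_mx 0 (lshift r a) - x a ^+ (l + r).-1 *: delta_mx 0 (rshift l b)).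
  apply/eqP => /matrixP/(_ 0 (lshift r a))/eqP.
  by rewrite !mxE !eqxx eq_lrshift mulr0 subr0 oner_eq0.
rewrite mulmxBl -scalemxAl -!rowE; apply/rowP => k.
rewrite [LHS]mxE [(- _ : 'M__) _ _]mxE [(_ *: _ : 'M__) _ _]mxE [RHS]mxE.
rewrite [row (lshift _ _) _ _ _]mxE [row (rshift _ _) _ _ _]mxE !interp_mxE.
have k_le : (k <= (l + r).-1)%N by rewrite -ltnS (ltn_predK (ltn_ord k)).
by rewrite -{2}(subnK k_le) exprD -mulrA -exprMn xy expr1n mulr1 subrr.
Qed.

(** Multiplying the row of x_a by z_a^(N-1) turns x_a^(N-1-k) into z_a^k. *)
Lemma det_interp_mx_Vandermonde (F : fieldType) (x : 'I_l -> F) (z : 'I_(l + r) -> F) :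
    (forall a, x a * z (lshift r a) = 1) ->
  (\prod_a z (lshift r a)) ^+ (l + r).-1
    * \det (interp_mx x (z \o @rshift l r)) =
  \det (Vandermonde (l + r) (\row_i z i)).
Proof.
move=> xz; rewrite -[RHS]det_tr.
pose D := row_mx (\row_a z (lshift r a) ^+ (l + r).-1) (const_mx 1) : 'rV_(l + r).
transitivity (\det (diag_mx D *m interp_mx x (z \o @rshift l r))).
  rewrite det_mulmx det_diag big_split_ord /= [X in _ * X * _]big1; last first.
    by move=> b _; rewrite row_mxEr mxE.
  rewrite mulr1 -prodrXl; congr (_ * _); apply: eq_bigr => a _.
  by rewrite row_mxEl mxE.
congr (\det _); apply/matrixP => k k'; rewrite mul_diag_mx.
rewrite [LHS]mxE [RHS]mxE [RHS]mxE [X in X ^+ _]mxE -[k]splitK.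
case: (split k) => a /=; rewrite !interp_mxE.
  rewrite row_mxEl mxE.
  have k_le : (k' <= (l + r).-1)%N by rewrite -ltnS (ltn_predK (ltn_ord k')).
  by rewrite -{1}(subnK k_le) exprD mulrAC -exprMn mulrC [z _ * _]mulrC xz expr1n mulr1.
by rewrite row_mxEr mxE mul1r.
Qed.

End InterpolationMatrix.

(** * The divisor V *)

Section Kernel.
Variables (C : numFieldType) (l r : nat).
Implicit Types (z : 'I_(l + r) -> C).

(* The indices of the linear factors of the polynomial V above. *)
Definition vfactor_idx : seq ('I_(l + r) * 'I_(l + r) * bool) :=
  enum [pred t : 'I_(l + r) * 'I_(l + r) * bool |
    [&& t.1.1 < t.1.2, t.1.1 < l & t.2 || (t.1.2 < l)]%N].

Definition vfactor : {mpoly C[l + r]} := \prod_(t <- vfactor_idx) lin C t.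

Lemma meval_vfactor z : vfactor.@[z] =
  \det (Vandermonde l (\row_a z (lshift r a) ^+ 2))
  * \prod_a \prod_b (z (lshift r a) + z (rshift l b)).
Proof.
rewrite /vfactor rmorph_prod /=; under eq_bigr do rewrite meval_lin.
rewrite /vfactor_idx big_enum big_mkcond /=.
pose F i j b := if [&& (i : 'I_(l + r)) < (j : 'I_(l + r)), i < l & b || (j < l)]%N
  then z j - (-1) ^+ (b : bool) * z i else 1.
rewrite -(pair_bigA _ (fun ij b => F ij.1 ij.2 b)) /=.
rewrite -(pair_bigA _ (fun i j => \prod_b F i j b)) /=.
rewrite big_split_ord /= [X in _ * X]big1 ?mulr1; last first.
  move=> b _; apply: big1 => j _; apply: big1 => c _.
  by rewrite /F (_ : rshift l b < l = false)%N ?andbF // ltnNge leq_addr.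
rewrite det_Vandermonde -big_split; apply: eq_bigr => a _ /=.
rewrite big_split_ord /= [in RHS]big_mkcond; congr (_ * _).
  apply: eq_bigr => a' _; rewrite big_bool /F /= !ltn_ord /= !mxE.
  by case: (a < a')%N; rewrite /= ?andbF; ring.
apply: eq_bigr => b _; rewrite big_bool /F /= ltn_ord.
rewrite [(l + b < l)%N]ltnNge leq_addr /= andbF mulr1.
rewrite (leq_trans (ltn_ord a)) ?leq_addr //=.
by ring.
Qed.

Lemma meval_vfactor_scale (c : C) z :
  vfactor.@[fun k => c * z k] = c ^+ ((l + r).-1 * l) * vfactor.@[z].
Proof.
rewrite !meval_vfactor mulrA.
have -> : Vandermonde l (\row_a (c * z (lshift r a)) ^+ 2) =
          diag_mx (\row_k (c ^+ 2) ^+ k) *m Vandermonde l (\row_a z (lshift r a) ^+ 2).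
  by apply/matrixP => k k'; rewrite mul_diag_mx !mxE !exprMn mulrACA.
rewrite det_mulmx det_diag.
have -> : ((l + r).-1 * l = 2 * (\sum_(k < l) k) + l * r)%N.
  have -> : (2 * (\sum_(k < l) k) = l * l.-1)%N.
    elim: (l) => [|k IH]; rewrite ?big_ord0 // big_ord_recr mulnDr IH.
    by case: k {IH} => //= k; nia.
  by nia.
rewrite exprD exprM expr_sum -!mulrA; congr (_ * _).
  by apply: eq_bigr => k _; rewrite mxE.
rewrite mulrCA; congr (_ * _).
have -> : c ^+ (l * r) = \prod_(a < l) \prod_(b < r) c.
  by rewrite !prodr_const !card_ord mulnC exprM.
rewrite -big_split; apply: eq_bigr => a _ /=.
by rewrite -big_split /=; apply: eq_bigr => b _; rewrite mulrDr.
Qed.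

(** Whichever block k lies in, z_a + z_k divides V: inside the first block it is a factor of the
    difference of squares. *)
Lemma meval_vfactor_eq0 z a k :
  lshift r a != k -> z (lshift r a) = - z k -> vfactor.@[z] = 0.
Proof.
move=> ne_ak zak; rewrite /vfactor rmorph_prod /=.
have [t tK t0] : exists2 t, t \in vfactor_idx & (lin C t).@[z] = 0.
  have [ltak|ltka] : (lshift r a < k)%N \/ (k < lshift r a)%N.
    by apply/orP; rewrite -neq_ltn.
  - exists (lshift r a, k, true); first by rewrite mem_enum inE /= ltak ltn_ord.
    by rewrite meval_lin /= zak; ring.
  - exists (k, lshift r a, true).
      by rewrite mem_enum inE /= ltka (ltn_trans ltka (ltn_ord a)).
    by rewrite meval_lin /= zak; ring.
by rewrite (big_rem t) //= t0 mul0r.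
Qed.

Lemma vfactor_neq0 : vfactor != 0.
Proof.
apply: (@mpoly_neq0_meval _ _ _ (fun k => (val k).+1%:R)).
rewrite meval_vfactor mulf_neq0 //.
  apply: (det_Vandermonde_neq0 (c := fun a : 'I_l => ((a.+1)%:R : C) ^+ 2)).
  by move=> a a' /eqP; rewrite -!natrX eqr_nat eqn_exp2r // eqSS => /eqP/val_inj.
apply/prodf_neq0 => a _; apply/prodf_neq0 => b _.
by rewrite -natrD pnatr_eq0.
Qed.

Lemma meval_vfactor_bperm z (u : 'S_l) (v : 'S_r) :
  vfactor.@[z \o bperm u v] = (-1) ^+ odd_perm u * vfactor.@[z].
Proof.
rewrite !meval_vfactor mulrA; congr (_ * _); last first.
  rewrite [RHS](reindex_perm u) /=; apply: eq_bigr => a _.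
  rewrite [RHS](reindex_perm v) /=; apply: eq_bigr => b _.
  by rewrite bpermL bpermR.
rewrite -det_perm -[LHS]det_tr -[X in _ * X]det_tr -det_mulmx -row_permE.
by congr (\det _); apply/matrixP => a a'; rewrite !mxE /= bpermL.
Qed.

End Kernel.

(** * Construction of minimal elements *)

Section VandermondePolynomial.
Variables (C : numFieldType) (n : nat).

(** Delta is written with the forms [lin] so that [dvd_prod_lin] applies to it. *)
Definition vdm_idx : seq ('I_n * 'I_n * bool) :=
  enum [pred t : 'I_n * 'I_n * bool | (t.1.1 < t.1.2)%N && ~~ t.2].

Definition vdm : {mpoly C[n]} := \prod_(t <- vdm_idx) lin C t.

Lemma meval_vdm z : vdm.@[z] = \det (Vandermonde n (\row_i z i)).
Proof.
rewrite /vdm rmorph_prod /=; under eq_bigr do rewrite meval_lin.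
rewrite /vdm_idx big_enum big_mkcond /= det_Vandermonde.
pose F (i j : 'I_n) (b : bool) :=
  if (i < j)%N && ~~ b then z j - (-1) ^+ b * z i else 1.
rewrite -(pair_bigA _ (fun ij b => F ij.1 ij.2 b)) /=.
rewrite -(pair_bigA _ (fun i j => \prod_b F i j b)) /=.
apply: eq_bigr => a _; rewrite [RHS]big_mkcond; apply: eq_bigr => b _.
by rewrite big_bool /F /= andbF andbT !mxE; case: ifP => _; ring.
Qed.

Lemma vdm_neq0 : vdm != 0.
Proof.
apply: (@mpoly_neq0_meval _ _ _ (fun k => (val k)%:R)); rewrite meval_vdm.
apply: det_Vandermonde_neq0 => i j /eqP.
by rewrite eqr_nat => /eqP/val_inj.
Qed.

Lemma meval_vdm_neq0 z : vdm.@[z] != 0 -> injective z.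
Proof.
rewrite meval_vdm det_Vandermonde => /prodf_neq0 nz i j zij.
have lt_false (a b : 'I_n) : z a = z b -> ~~ (a < b)%N.
  move=> zab; apply/negP => ab; have /prodf_neq0/(_ b ab) := nz a isT.
  by rewrite !mxE zab subrr eqxx.
apply: val_inj; apply/eqP; rewrite eqn_leq leqNgt lt_false //=.
by rewrite leqNgt lt_false.
Qed.

Lemma meval_vdm_perm z (s : 'S_n) :
  vdm.@[z \o s] = (-1) ^+ odd_perm s * vdm.@[z].
Proof.
rewrite !meval_vdm -det_perm -[LHS]det_tr -[X in _ * X]det_tr -det_mulmx.
by rewrite -row_permE; congr (\det _); apply/matrixP => a a'; rewrite !mxE.
Qed.

Lemma vdm_dvd p :
    (forall z (s : 'S_n), p.@[z \o s] = (-1) ^+ odd_perm s * p.@[z]) ->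
  exists q, p = vdm * q.
Proof.
move=> skp; apply: dvd_prod_lin; first exact: enum_uniq.
  by move=> t; rewrite mem_enum inE => /andP[].
move=> [[i j] b]; rewrite mem_enum inE /= => /andP[lt_ij /negPf->].
apply: mpoly_eq0_meval => z; rewrite meval_elim_lin /= expr0 mul1r.
set v := fun k => _; have := skp v (tperm i j).
rewrite odd_tperm (_ : i != j) ?mulN1r; last by rewrite neq_ltn lt_ij.
rewrite (@meval_eq _ _ _ v) => [/eqP|k] /=.
  by rewrite -addr_eq0 -mulr2n mulrn_eq0 => /eqP.
by rewrite /v; case: tpermP => [->|->|//]; rewrite eqxx; case: eqP => // ->.
Qed.

End VandermondePolynomial.

Section Construction.
Variables (C : numFieldType) (l r : nat).
Local Notation N := (l + r)%N.
Local Notation T := {mpoly {mpoly C[N]}[l]}.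
Implicit Types (x : 'I_l -> C) (z : 'I_N -> C) (P : T).

(** The numerator of P for the monomial h = z^m. No symmetry of h is required, since the sum over
    S_N symmetrises it. *)
Definition alt_sum (m : 'X_{1..N}) : T :=
  \sum_(w : 'S_N) ((-1) ^+ odd_perm w *: msym w ('X_[m] * vfactor C l r)) *:
    \det (interp_mx (fun a => 'X_a) (fun b => ('X_(w (rshift l b)))%:MP)).

Definition alt_term m x z :=
  ('X_[m] * vfactor C l r).@[z] * \det (interp_mx x (z \o @rshift l r)).

Lemma ev2_det n x z (M : 'M[T]_n) :
  ev2 x z (\det M) = \det (\matrix_(i, j) ev2 x z (M i j)).
Proof.
rewrite /determinant rmorph_sum /=; apply: eq_bigr => s _.
rewrite rmorphM /= rmorph_prod /= rmorph_sign.
by congr (_ * _); apply: eq_bigr => i _; rewrite mxE.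
Qed.

Lemma ev2_alt_sum m x z : ev2 x z (alt_sum m) =
  \sum_(w : 'S_N) (-1) ^+ odd_perm w * alt_term m x (z \o w).
Proof.
rewrite rmorph_sum /=; apply: eq_bigr => w _.
rewrite ev2Z mevalZ meval_msym -mulrA /alt_term; congr (_ * _); congr (_ * _).
rewrite ev2_det; congr (\det _); apply/matrixP => k k'; rewrite [LHS]mxE -[k]splitK.
case: (split k) => a; rewrite !interp_mxE /= rmorphXn /=; congr (_ ^+ _).
  exact: ev2X.
by rewrite ev2C mevalXU.
Qed.

Lemma ev2_alt_sum_perm m x z (s : 'S_N) :
  ev2 x (z \o s) (alt_sum m) = (-1) ^+ odd_perm s * ev2 x z (alt_sum m).
Proof.
rewrite !ev2_alt_sum [in RHS](reindex_inj (mulIg s)) mulr_sumr /=.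
apply: eq_bigr => w _; rewrite odd_permM signr_addb [RHS]mulrA.
rewrite [X in _ = X * _]mulrCA -expr2 sqrr_sign mulr1.
congr (_ * _); rewrite /alt_term; congr (_ * _).
  by apply: meval_eq => k; rewrite /= permM.
by congr (\det _); apply/matrixP => k k'; rewrite -[k]splitK; case: (split k) => a;
  rewrite !interp_mxE //= permM.
Qed.

(** The values alternate in z, hence so does each coefficient of a monomial in X; the division by
    Delta is made coefficient by coefficient. *)
Lemma alt_sum_dvd m : exists P, vdm C N *: P = alt_sum m.
Proof.
have coef_dvd a : exists q, (alt_sum m)@_a = vdm C N * q.
  apply: vdm_dvd => z s; apply: ev2_coeff => x.
  exact: ev2_alt_sum_perm.
have [q qP] := boolp.choice coef_dvd.
exists (\sum_(a <- msupp (alt_sum m)) q a *: 'X_[a]).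
rewrite [RHS]mpolyE scaler_sumr; apply: eq_bigr => a _.
by rewrite scalerA -qP.
Qed.

Lemma msupp_alt_sum m (a : 'X_{1..l}) k :
  a \in msupp (alt_sum m) -> (a k < N)%N.
Proof.
move=> /msupp_sum_le/flatten_mapP[w _] /msuppZ_le.
rewrite /determinant => /msupp_sum_le/flatten_mapP[s _].
have -> : \prod_i interp_mx (fun a => 'X_a) (fun b => ('X_(w (rshift l b)))%:MP) i (s i)
    = (\prod_b 'X_(w (rshift l b)) ^+ s (rshift l b))
      *: 'X_[[multinom (N.-1 - s (lshift r a))%N | a < l]] :> T.
  rewrite big_split_ord /= -mul_mpolyC mulrC; congr (_ * _).
    rewrite rmorph_prod; apply: eq_bigr => b _.
    by rewrite interp_mxE /= rmorphXn.
  rewrite mpolyXE_id; apply: eq_bigr => b _.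
  by rewrite interp_mxE mnmE.
rewrite mulr_sign; case: ifP => _; rewrite ?(perm_mem (msuppN _)) => /msuppZ_le;
 by rewrite msuppX inE => /eqP->; rewrite mnmE; have := ltn_ord (lshift r k); lia.
Qed.

Section Quotient.
Variables (m : 'X_{1..N}) (P : T).
Hypothesis defP : vdm C N *: P = alt_sum m.

Lemma ev2_quotient x z : (vdm C N).@[z] * ev2 x z P = ev2 x z (alt_sum m).
Proof. by rewrite -ev2Z defP. Qed.

Lemma quotient_Cspace : Cspace P.
Proof.
split.
- move=> s; apply: (ev2_dense (vdm_neq0 C N)) => x z Vz.
  rewrite ev2_msym ev2Z rmorphXn rmorphN rmorph1; apply: (mulfI Vz).
  rewrite [RHS]mulrCA !ev2_quotient !ev2_alt_sum mulr_sumr; apply: eq_bigr => w _.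
  by rewrite /alt_term det_interp_mx_permL [RHS]mulrCA; congr (_ * _); rewrite mulrCA.
- move=> a k; rewrite mcoeff_msupp => a_nz; apply: (@msupp_alt_sum m).
  by rewrite mcoeff_msupp -defP mcoeffZ mulf_neq0 // vdm_neq0.
(* Delta and the numerator change by the same sign under s, so their quotient is invariant wherever
   Delta is nonzero. *)
- move=> a; apply/issymP => s; apply: mpoly_eq_dense (vdm_neq0 C N) _ => z Vz.
  rewrite meval_msym.
  rewrite -[RHS]mul1r; apply: ev2_coeff => x; rewrite mul1r.
  have Vz' : (vdm C N).@[z \o s] != 0.
    by rewrite meval_vdm_perm mulf_neq0 ?signr_eq0.
  apply: (mulfI Vz'); rewrite ev2_quotient ev2_alt_sum_perm meval_vdm_perm.
  by rewrite -mulrA ev2_quotient.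
Qed.


(** Let w send k to b. If k lies in the first block, z_b + z_c is a factor of the permuted V;
    otherwise z_b occupies a lower row of the matrix, proportional to the row of x_a. *)
Lemma alt_term_eq0 x z a b c :
  x a * z b = 1 -> b != c -> z b = - z c ->
  forall w : 'S_N, alt_term m x (z \o w) = 0.
Proof.
move=> xz ne_bc zbc w; rewrite /alt_term mevalM.
have wb : w ((w^-1)%g b) = b by rewrite permKV.
have wc : w ((w^-1)%g c) = c by rewrite permKV.
case: (split_ordP ((w^-1)%g b)) => [a' e|b' e].
  rewrite (@meval_vfactor_eq0 _ _ _ _ a' ((w^-1)%g c)) ?mulr0 ?mul0r //=.
    by rewrite -e (inj_eq perm_inj).
  by rewrite -e wb wc.
by rewrite (@det_interp_mx_eq0 _ _ _ _ _ a b') ?mulr0 //= -e wb.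
Qed.

(* The numerator vanishes termwise on z_b = - z_c; where vdm also vanishes, P
   is dealt with by density in the remaining variables. *)
Lemma quotient_minimal : minimal P.
Proof.
move=> x z a b c _ bN cN xa_nz xz zbc.
have ne_bc : b != c by rewrite -(inj_eq val_inj) /=; lia.
have zb_nz : z b != 0 by rewrite -xz invr_neq0.
pose f k : {mpoly C[N]} :=
  if k == b then (z b)%:MP else if k == c then (z c)%:MP else 'X_k.
pose f_ v k := if k == b then z b else if k == c then z c else v k.
have f_E v p : (p \mPo [tuple f k | k < N]).@[v] = p.@[f_ v].
  rewrite meval_comp_mktuple; apply: meval_eq => k; rewrite /f /f_.
  by case: ifP => _; [rewrite mevalC | case: ifP => _; rewrite ?mevalC ?mevalXU].
have D_nz : vdm C N \mPo [tuple f k | k < N] != 0.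
  (* Divided by z_b, this point has entry 1 at b, -1 at c and k+2 at every other k, and these are
     distinct. *)
  apply: (@mpoly_neq0_meval _ _ _ (fun k => z b * (k.+2)%:R)).
  rewrite f_E meval_vdm; apply: det_Vandermonde_neq0.
  pose g k : C := if k == b then 1 else if k == c then -1 else k.+2%:R.
  have f_g k : f_ (fun k : 'I_N => z b * (k.+2)%:R) k = z b * g k.
    rewrite /f_ /g; case: ifP => _; first by rewrite mulr1.
    by case: ifP => // _; rewrite zbc mulrN1 opprK.
  have neqN1 (k : nat) : k.+1%:R != -1 :> C by rewrite -addr_eq0 natr1 pnatr_eq0.
  have neq1 (k : nat) : k.+2%:R != 1 :> C by rewrite pnatr_eq1.
  move=> k k'; rewrite !f_g => /(mulfI zb_nz); rewrite /g.
  case: (eqVneq k b) => [->|_]; case: (eqVneq k' b) => [->|_] //.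
  - case: eqP => _ /eqP; last by rewrite eq_sym (negPf (neq1 _)).
    by rewrite (negPf (neqN1 0)).
  - case: eqP => _ /eqP; last by rewrite (negPf (neq1 _)).
    by rewrite eq_sym (negPf (neqN1 0)).
  - case: (eqVneq k c) => [->|_]; case: (eqVneq k' c) => [->|_] // /eqP.
    + by rewrite eq_sym (negPf (neqN1 _)).
    + by rewrite (negPf (neqN1 _)).
    + by rewrite eqr_nat => /eqP[/val_inj].
set p := P.@[fun k => (x k)%:MP].
suff : p \mPo [tuple f k | k < N] = 0.
  move/(congr1 (meval z)); rewrite f_E meval0 => <-; apply: meval_eq => k.
  by rewrite /f_; case: eqP => [->//|_]; case: eqP => [->|].
apply: (mpoly_eq_dense D_nz) => v; rewrite !f_E meval0 => Dv.
apply: (mulfI Dv); rewrite mulr0 -[p.@[_]]/(ev2 x (f_ v) P) ev2_quotient.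
rewrite ev2_alt_sum big1 // => w _; rewrite (@alt_term_eq0 _ _ a b c) ?mulr0 //.
  by rewrite /f_ eqxx -xz mulfV.
by rewrite /f_ !eqxx eq_sym (negPf ne_bc).
Qed.

(** Each monomial of the orbit is counted once per element of a stabiliser, whence the constant
    factor in the realisation of h. *)
Definition orbit_sum : {mpoly C[N]} :=
  \sum_(uv : 'S_l * 'S_r) msym (bperm uv.1 uv.2) 'X_[m].

End Quotient.

Lemma sum_bperm (F : 'S_N -> C) :
    (forall (w : 'S_N) a b, w (rshift l b) = lshift r a -> F w = 0) ->
  \sum_w F w = \sum_(uv : 'S_l * 'S_r) F (bperm uv.1 uv.2).
Proof.
move=> F0; pose B := [set bperm uv.1 uv.2 | uv : 'S_l * 'S_r].
rewrite (bigID (mem B)) /= [X in _ + X]big1 ?addr0 => [|w].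
  by rewrite big_imset //= => uv uv' _ _; apply: bperm_inj.
case: (bpermP w) => [[uv ->]|[a [b /F0//]]]; case/negP.
by apply/imsetP; exists uv.
Qed.

(* h is the quotient of the values of P at X_a = 1/z_a by the polynomial V. *)
Definition evrel P (h : {mpoly C[N]}) := forall z,
  (forall k, z k != 0) -> injective z ->
  (\prod_a z (lshift r a)) ^+ N.-1 * ev2 (fun a => (z (lshift r a))^-1) z P =
  (vfactor C l r * h).@[z].

(** Only block permutations w = (u, v) contribute. The sign of w is cancelled by the sign of u
    coming from V and that of v coming from det A, so the terms add up without signs. *)
Lemma quotient_evrel m P : vdm C N *: P = alt_sum m -> evrel P (orbit_sum m).
Proof.
move=> defP z z_nz z_inj; set x := fun a => (z (lshift r a))^-1.
have Vz : (vdm C N).@[z] != 0 by rewrite meval_vdm det_Vandermonde_neq0.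
apply: (mulfI Vz); rewrite mulrCA (ev2_quotient defP) ev2_alt_sum.
rewrite sum_bperm; last first.
  move=> w a b wab; rewrite /alt_term (@det_interp_mx_eq0 _ _ _ _ _ a b) ?mulr0 //=.
  by rewrite wab mulVf.
rewrite mevalM; set Kz := (vfactor _ _ _).@[z].
rewrite rmorph_sum /= mulrA [LHS]mulr_sumr [RHS]mulr_sumr; apply: eq_bigr => -[u v] _ /=.
rewrite meval_msym /alt_term mevalM sign_bperm.
rewrite [(vfactor _ _ _).@[_]]meval_vfactor_bperm -/Kz.
have -> : \det (interp_mx x ((z \o bperm u v) \o @rshift l r)) =
    (-1) ^+ odd_perm v * \det (interp_mx x (z \o @rshift l r)).
  rewrite -det_interp_mx_permR; congr (\det _); apply/matrixP => k k'.
  by rewrite -[k]splitK; case: (split k) => a; rewrite !interp_mxE //= bpermR.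
rewrite meval_vdm -(@det_interp_mx_Vandermonde _ _ _ x) => [|a]; last exact: mulVf.
have := @sqrr_sign C (odd_perm u); have := @sqrr_sign C (odd_perm v).
set su := (-1) ^+ odd_perm u; set sv := (-1) ^+ odd_perm v => sv2 su2.
rewrite -[meval (z \o _) _]/('X_[m].@[fun k => z (bperm u v k)]).
transitivity (su ^+ 2 * sv ^+ 2 * ((\prod_a z (lshift r a)) ^+ N.-1 *
   \det (interp_mx x (z \o @rshift l r)) *
   Kz * 'X_[m].@[fun k => z (bperm u v k)])); first ring.
by rewrite su2 sv2 !mul1r; ring.
Qed.

End Construction.

(** * Values of minimal elements *)

Section Scaling.
Variables (C : numFieldType) (n : nat).

(** Homogeneity is known through values under rescaling; this transfers it to coefficients. *)
Lemma mpoly_rescale (c : C) (q : {mpoly C[n]}) : exists q' : {mpoly C[n]},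
  (forall v, q'.@[v] = q.@[fun k => c * v k]) /\
  (forall a, q'@_a = c ^+ mdeg a * q@_a).
Proof.
elim/mpolyind: q => [|d m q _ _ [q' [q'v q'c]]].
  by exists 0; split=> [v|a]; rewrite ?meval0 // !mcoeff0 mulr0.
exists ((c ^+ mdeg m * d) *: 'X_[m] + q'); split=> [v|a].
  rewrite !mevalD q'v !mevalZ !mevalX; congr (_ + _).
  under [in RHS]eq_bigr do rewrite exprMn.
  by rewrite big_split /= -expr_sum -mdegE; ring.
rewrite !mcoeffD q'c !mcoeffZ mcoeffX; case: eqP => [->|_] /=; ring.
Qed.

Lemma mcoeff_rescale (c : C) (p q : {mpoly C[n]}) :
    (forall v, p.@[v] = q.@[fun k => c * v k]) ->
  forall a, p@_a = c ^+ mdeg a * q@_a.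
Proof.
move=> pq a; have [q' [q'v <-]] := mpoly_rescale c q; congr (_@__).
by apply: mpoly_eq_meval => v; rewrite pq q'v.
Qed.

End Scaling.

Section Interpolation.
Variables (C : numFieldType) (l r : nat).
Local Notation N := (l + r)%N.
Local Notation T := {mpoly {mpoly C[N]}[l]}.
Implicit Types (x : 'I_l -> C) (z : 'I_N -> C) (P : T).

Lemma alt_term_scale (c : C) m x z :
  alt_term m x (fun k => c * z k) =
  c ^+ mdeg m * c ^+ (\sum_(k < N) k) * alt_term m (fun a => c * x a) z.
Proof.
rewrite /alt_term !mevalM meval_vfactor_scale !mevalX.
under eq_bigr do rewrite exprMn; rewrite big_split /= -expr_sum -mdegE.
have := det_interp_mx_scale c x (z \o @rshift l r).
rewrite -[interp_mx x (_ \o _)]/(interp_mx x (fun b => c * (z \o @rshift l r) b)).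
set D1 := \det _; set D2 := \det _ => e; set Kz := meval z _.
transitivity (c ^+ mdeg m * \prod_i z i ^+ m i * Kz * (c ^+ (N.-1 * l) * D1)).
  by ring.
by rewrite e; ring.
Qed.

Lemma meval_vdm_scale (c : C) n (z : 'I_n -> C) :
  (vdm C n).@[fun k => c * z k] = c ^+ (\sum_(k < n) k) * (vdm C n).@[z].
Proof.
rewrite !meval_vdm expr_sum.
have -> : \prod_(k < n) c ^+ k = \det (diag_mx (\row_(k < n) c ^+ k)).
  by rewrite det_diag; apply: eq_bigr => k _; rewrite mxE.
rewrite -det_mulmx; congr (\det _); apply/matrixP => k k'.
by rewrite mul_diag_mx !mxE exprMn.
Qed.

(** The scalings of V and det A combine to c^(N(N-1)/2), which Delta absorbs. The outcome is
    homogeneity of degree |m| for X_a of degree -1. *)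
Lemma ev2_quotient_scale m P x z (c : C) : vdm C N *: P = alt_sum C m -> c != 0 ->
    (vdm C N).@[z] != 0 ->
  ev2 x (fun k => c * z k) P = c ^+ mdeg m * ev2 (fun a => c * x a) z P.
Proof.
move=> defP c_nz Vz.
apply: (mulfI (mulf_neq0 (expf_neq0 (\sum_(k < N) k) c_nz) Vz)).
rewrite -{1}meval_vdm_scale (ev2_quotient defP) mulrACA (ev2_quotient defP).
rewrite !ev2_alt_sum mulr_sumr; apply: eq_bigr => w _.
have := alt_term_scale c m x (z \o w).
set A1 := alt_term _ _ _; set A2 := alt_term _ _ _ => e.
by clearbody A1 A2; rewrite e; move: (_ ^+ odd_perm w) => s; ring.
Qed.

Lemma quotient_homog m P a b : vdm C N *: P = alt_sum C m ->
  b \in msupp P@_a -> mdeg b = (mdeg m + mdeg a)%N.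
Proof.
(* The single scale 2 suffices, its powers being distinct in characteristic 0. *)
move=> defP; have two_nz : 2%:R != 0 :> C by rewrite pnatr_eq0.
have scale_a : forall z, (vdm C N).@[z] != 0 ->
    (P@_a).@[fun k => 2%:R * z k] = (2%:R ^+ (mdeg m + mdeg a) *: P@_a).@[z].
  move=> z Vz; rewrite -mcoeff_map_mpoly.
  rewrite (@mcoeff_rescale _ _ 2%:R _ (2%:R ^+ mdeg m *: map_mpoly (meval z) P)).
    by rewrite mcoeffZ mcoeff_map_mpoly mevalZ exprD; ring.
  move=> x; rewrite -ev2_map mevalZ -ev2_map; exact: ev2_quotient_scale.
have [q' [q'v q'c]] := mpoly_rescale 2%:R P@_a.
have eq' : q' = 2%:R ^+ (mdeg m + mdeg a) *: P@_a.
  by apply: mpoly_eq_dense (vdm_neq0 C N) _ => z Vz; rewrite q'v scale_a.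
rewrite mcoeff_msupp => b_nz; move/(congr1 (mcoeff b)): eq'.
rewrite q'c mcoeffZ => /(mulIf b_nz)/eqP.
by rewrite -!natrX eqr_nat eqn_exp2l // => /eqP.
Qed.

(** This is (z_1 ... z_l)^(N-1) P at X_a = 1/z_a as a polynomial; the degree bound on P keeps the
    truncated subtraction exact. *)
Definition ev_poly P : {mpoly C[N]} :=
  \sum_(a <- msupp P) P@_a * \prod_k 'X_(lshift r k) ^+ (N.-1 - a k).

Lemma meval_ev_poly P z : Cspace P -> (forall k, z k != 0) ->
  (ev_poly P).@[z] =
  (\prod_a z (lshift r a)) ^+ N.-1 * ev2 (fun a => (z (lshift r a))^-1) z P.
Proof.
case=> _ degP _ z_nz; rewrite ev2E rmorph_sum mulr_sumr /=.
rewrite [LHS]big_seq [RHS]big_seq; apply: eq_bigr => a aP.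
rewrite mevalM [RHS]mulrCA; congr (_ * _).
rewrite rmorph_prod /= -prodrXl.
rewrite -big_split; apply: eq_bigr => k _ /=.
rewrite rmorphXn /= mevalXU exprVn expfB_cond ?(negPf (z_nz _)) //.
by have := degP a k aP; lia.
Qed.

Lemma perm_extend (f : 'I_l -> 'I_N) : injective f ->
  exists w : 'S_N, forall a, w (lshift r a) = f a.
Proof.
move=> f_inj; pose B := ~: [set f a | a : 'I_l].
have cardB : #|B| = r.
  by have := cardsC [set f a | a : 'I_l]; rewrite card_imset // !card_ord -/B; lia.
pose g b : 'I_N := enum_val (cast_ord (esym cardB) b).
have gB b : g b \notin [set f a | a : 'I_l] by rewrite -in_setC; apply: enum_valP.
pose w k := match split k with inl a => f a | inr b => g b end.
have w_inj : injective w.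
  move=> k k'; rewrite -[k]splitK -[k']splitK.
  case: (split k) => a; case: (split k') => b; rewrite /w !unsplitK.
  - by move=> /f_inj->.
  - by move=> e; have := gB b; rewrite -e imset_f.
  - by move=> e; have := gB a; rewrite e imset_f.
  - by move=> /enum_val_inj/cast_ord_inj->.
by exists (perm w_inj) => a; rewrite permE /w (unsplitK (inl a)).
Qed.

Lemma meval_prodX_neq0 n (z : 'I_n -> C) :
  (\prod_(k < n) 'X_k).@[z] != 0 -> forall k, z k != 0.
Proof.
rewrite rmorph_prod /= => /prodf_neq0 nz k.
by have := nz k isT; rewrite mevalXU.
Qed.

Lemma prodX_neq0 n : \prod_(k < n) 'X_k != 0 :> {mpoly C[n]}.
Proof. by apply/prodf_neq0 => k _; rewrite -msupp_eq0 msuppX. Qed.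

Lemma evrel_inj P : Cspace P -> evrel P 0 -> P = 0.
Proof.
case=> skP degP symP P0; apply/mpolyP => a; rewrite mcoeff0.
apply: (mpoly_eq_dense (mulf_neq0 (vdm_neq0 C N) (prodX_neq0 N))) => z.
rewrite mevalM mulf_eq0 negb_or meval0.
case/andP => /meval_vdm_neq0 z_inj /meval_prodX_neq0 z_nz.
rewrite -mcoeff_map_mpoly (_ : map_mpoly _ _ = 0) ?mcoeff0 //.
apply: (@mpoly_grid_eq0 _ N _ (fun k => (z k)^-1)).
- by move=> k k' /invr_inj/z_inj.
- move=> m k; rewrite mcoeff_msupp mcoeff_map_mpoly => m_nz; apply: degP.
  by rewrite mcoeff_msupp; apply: contraNneq m_nz => ->; apply/eqP/meval0.
move=> f; rewrite -ev2_map.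
have [/injectiveP f_inj|] := boolP (injectiveb f); last first.
  case/injectivePn => k [k' ne_kk' fkk'].
  by apply: (skew_ev2_eq0 _ skP ne_kk'); rewrite fkk'.
(* By symmetry in z, the value at this grid point equals the standard value X_a = 1/z_a taken at the
   permuted point [z \o w]. *)
have [w wf] := perm_extend f_inj.
rewrite -(ev2_sym w) //.
have := P0 (z \o w) (fun k => z_nz _) (inj_comp z_inj perm_inj).
rewrite mulr0 meval0 => /eqP; rewrite mulf_eq0 expf_eq0 => /orP[/andP[_]|/eqP].
  by rewrite prodf_seq_eq0 => /hasP[k _ /=]; rewrite (negPf (z_nz _)).
by move=> <-; apply: eq_ev2 => // k /=; rewrite wf.
Qed.

(** Minimality speaks only of X_l, z_(N-1) and z_N. Skew-symmetry in X and symmetry in z carry it to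
    any a and any two distinct indices. *)
Lemma minimal_ev2 P x z a i j : W P -> x a != 0 -> (x a)^-1 = z i ->
  i != j -> z i = - z j -> ev2 x z P = 0.
Proof.
case=> [[skP _ symP] minP] xa_nz xz ne_ij zij.
have l_gt0 : (0 < l)%N by apply: leq_ltn_trans (ltn_ord a).
have N_gt1 : (1 < N)%N.
  have := ltn_ord i; have := ltn_ord j; move: ne_ij; rewrite -(inj_eq val_inj) /=; lia.
have lastP : (l.-1 < l)%N by lia.
have bP : (N.-2 < N)%N by lia.
have cP : (N.-1 < N)%N by lia.
pose last := Ordinal lastP; pose b := Ordinal bP; pose c := Ordinal cP.
have ne_bc : c != b by rewrite -(inj_eq val_inj) /=; lia.
pose s := tperm last a; pose w := (tperm b i * tperm (tperm b i c) j)%g.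
have wb : w b = i.
  rewrite permM tpermL tpermD // 1?eq_sym //.
  by rewrite -[X in X != _](tpermL b i) (inj_eq perm_inj) eq_sym.
have wc : w c = j by rewrite permM tpermL.
have : ev2 (x \o s) (z \o w) P = 0.
  apply: (minP _ _ last b c); rewrite /= ?wb ?wc /s ?tpermL //; lia.
rewrite ev2_sym // ev2_skew // => /eqP.
by rewrite mulf_eq0 signr_eq0 => /eqP.
Qed.

(** Minimality makes the value vanish on z_i + z_j = 0 for i in the first block, and skew-symmetry
    makes it vanish on z_i = z_j for both in the first block: these are the factors of V. The value
    and V change by the same sign under a block permutation, so the quotient is invariant. *)
Lemma evrel_exists P : W P -> exists h,
  evrel P h /\ forall u v, msym (bperm u v) h = h.
Proof.
move=> WP; have [CP _] := WP; have [skP _ symP] := CP.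
have [|||h eh] := @dvd_prod_lin _ _ (vfactor_idx l r) (ev_poly P).
- exact: enum_uniq.
- by move=> t; rewrite mem_enum => /and3P[].
- move=> [[i j] b]; rewrite mem_enum => /and3P[/= lt_ij i_l bj].
  apply: (mpoly_eq_dense (prodX_neq0 N)) => v /meval_prodX_neq0 v_nz.
  rewrite meval_elim_lin /= meval0; set v' := fun k => _.
  have v'_nz k : v' k != 0.
    by rewrite /v'; case: ifP => _ //; rewrite mulf_neq0 ?signr_eq0.
  rewrite meval_ev_poly //; apply/eqP; rewrite mulf_eq0; apply/orP; right; apply/eqP.
  have ne_ij : i != j by rewrite neq_ltn lt_ij.
  have v'i : v' i = v i by rewrite /v' (negPf ne_ij).
  have v'j : v' j = (-1) ^+ b * v i by rewrite /v' eqxx.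
  case: (split_ordP i) => [a ea|? e]; last by move: i_l; rewrite e /=; lia.
  case: b bj v' v'_nz v'i v'j => /= [_|j_l] v' v'_nz v'i v'j.
    apply: (@minimal_ev2 _ _ _ a i j) => //; first by rewrite invr_neq0.
      by rewrite invrK ea.
    by rewrite v'j v'i; ring.
  case: (split_ordP j) => [a' ea'|? e]; last by move: j_l; rewrite e /=; lia.
  apply: (@skew_ev2_eq0 _ _ _ _ _ _ a a') => //.
    by apply: contra ne_ij => /eqP e; rewrite ea ea' e.
  by rewrite -ea -ea' v'i v'j mul1r.
have hP : evrel P h by move=> z z_nz _; rewrite -meval_ev_poly // eh.
exists h; split=> // u v.
(* The quotient h is read off from values of P only where V is nonzero and z has distinct nonzero
   entries. *)
pose D := vfactor C l r * (vdm C N * \prod_(k < N) 'X_k).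
have D_nz : D != 0 by rewrite !mulf_neq0 ?vfactor_neq0 ?vdm_neq0 ?prodX_neq0.
apply: (mpoly_eq_dense D_nz) => z; rewrite !mevalM !mulf_eq0 !negb_or.
case/and3P => Kz /meval_vdm_neq0 z_inj /meval_prodX_neq0 z_nz; apply: (mulfI Kz).
apply: (mulfI (negbT (signr_eq0 _ (odd_perm u)))).
rewrite meval_msym [LHS]mulrA -(meval_vfactor_bperm z u v).
have := hP (z \o bperm u v) (fun k => z_nz _) (inj_comp z_inj perm_inj).
have := hP z z_nz z_inj; rewrite !mevalM => <-.
set hw := meval _ h; move=> <-; rewrite ev2_sym // mulrCA -ev2_skew //.
congr (_ ^+ _ * _); last by apply: eq_ev2 => // a /=; rewrite bpermL.
rewrite [RHS](reindex_perm u); apply: eq_bigr => a _ /=; by rewrite bpermL.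
Qed.

End Interpolation.

(** * A basis of W *)

Section Keys.
Variables l r : nat.
Local Notation N := (l + r)%N.
Implicit Types (k : seq nat * seq nat) (m : 'X_{1..N}).

(** A key is a pair of partitions with at most l and r parts, padded with zeros and listed in
    increasing order; such pairs represent the orbits of S_l x S_r on exponents. *)
Definition valid_key k :=
  [&& size k.1 == l, size k.2 == r, sorted leq k.1 & sorted leq k.2].

Definition key_mnm k : 'X_{1..N} := [multinom nth 0%N (k.1 ++ k.2) i | i < N].

Definition mnm_key m : seq nat * seq nat :=
  ([tuple m (lshift r a) | a < l] : seq nat, [tuple m (rshift l b) | b < r] : seq nat).

Lemma key_mnmL k a : size k.1 = l -> key_mnm k (lshift r a) = nth 0%N k.1 a.
Proof. by move=> e; rewrite mnmE nth_cat /= e ltn_ord. Qed.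

Lemma key_mnmR k b : size k.1 = l -> key_mnm k (rshift l b) = nth 0%N k.2 b.
Proof. by move=> e; rewrite mnmE nth_cat /= e ltnNge leq_addr /= addKn. Qed.

Lemma key_mnmK k : size k.1 = l -> size k.2 = r -> mnm_key (key_mnm k) = k.
Proof.
move=> e1 e2; rewrite [RHS]surjective_pairing; congr (_, _).
  apply: (@eq_from_nth _ 0%N); rewrite size_tuple // => n n_l.
  by rewrite -[n]/(val (Ordinal n_l)) nth_mktuple key_mnmL.
apply: (@eq_from_nth _ 0%N); rewrite size_tuple // => n n_r.
by rewrite -[n]/(val (Ordinal n_r)) nth_mktuple key_mnmR.
Qed.

Lemma mnm_keyK m : key_mnm (mnm_key m) = m.
Proof.
apply/mnmP => n; rewrite -[n]splitK; case: (split n) => a /=.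
  by rewrite key_mnmL ?size_tuple // nth_mktuple.
by rewrite key_mnmR ?size_tuple // nth_mktuple.
Qed.

Lemma mdeg_key_mnm k : size k.1 = l -> size k.2 = r ->
  mdeg (key_mnm k) = (sumn k.1 + sumn k.2)%N.
Proof.
move=> e1 e2; rewrite mdegE big_split_ord /= !sumnE.
rewrite (big_nth 0%N) e1 big_mkord [X in (_ = _ + X)%N](big_nth 0%N) e2 big_mkord.
by congr addn; apply: eq_bigr => a _; rewrite ?key_mnmL ?key_mnmR.
Qed.

Lemma mnm_key_mperm m (u : 'S_l) (v : 'S_r) :
  perm_eq (mnm_key [multinom m (bperm u v i) | i < N]).1 (mnm_key m).1 /\
  perm_eq (mnm_key [multinom m (bperm u v i) | i < N]).2 (mnm_key m).2.
Proof.
split; apply/tuple_permP; [exists u|exists v]; congr val; apply: eq_mktuple => a;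
  by rewrite mnmE tnth_mktuple ?bpermL ?bpermR.
Qed.

Lemma valid_key_mperm k k' u v : valid_key k -> valid_key k' ->
  [multinom key_mnm k (bperm u v i) | i < N] = key_mnm k' -> k = k'.
Proof.
case/and4P => /eqP l1 /eqP r1 s1 s2 /and4P[/eqP l1' /eqP r1' s1' s2'] e.
have [] := mnm_key_mperm (key_mnm k) u v; rewrite e !key_mnmK // => p1 p2.
rewrite [LHS]surjective_pairing [RHS]surjective_pairing; congr (_, _).
  apply: (sorted_eq leq_trans anti_leq) => //; rewrite perm_sym //.
by apply: (sorted_eq leq_trans anti_leq) => //; rewrite perm_sym.
Qed.

Lemma mperm_valid m : exists u v k,
  valid_key k /\ [multinom m (bperm u v i) | i < N] = key_mnm k.
Proof.
have [u eu] : exists u : 'S_l, sort leq (mnm_key m).1 =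
    [tuple tnth [tuple m (lshift r a) | a < l] (u a) | a < l].
  by apply/tuple_permP; rewrite perm_sort.
have [v ev] : exists v : 'S_r, sort leq (mnm_key m).2 =
    [tuple tnth [tuple m (rshift l a) | a < r] (v a) | a < r].
  by apply/tuple_permP; rewrite perm_sort.
exists u, v, (sort leq (mnm_key m).1, sort leq (mnm_key m).2); split.
  have e1 : size (mnm_key m).1 = l by exact: size_tuple.
  have e2 : size (mnm_key m).2 = r by exact: size_tuple.
  apply/and4P; split; rewrite ?size_sort ?e1 ?e2 //; exact: (sort_sorted leq_total).
rewrite eu ev -[LHS]mnm_keyK; congr (key_mnm (_, _)); congr val; apply: eq_mktuple => a;
  by rewrite mnmE tnth_mktuple ?bpermL ?bpermR.
Qed.

End Keys.

Section BasisOfW.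
Variables (C : numFieldType) (l r : nat).
Local Notation N := (l + r)%N.
Local Notation T := {mpoly {mpoly C[N]}[l]}.
Implicit Types (P Q : T) (k : seq nat * seq nat) (h : {mpoly C[N]}).

(** The coefficient counts the block permutations carrying one exponent to the other, and two sorted
    exponents in one orbit are equal. *)
Lemma orbit_sum_coeff k k' : valid_key l r k -> valid_key l r k' ->
  ((orbit_sum C (key_mnm l r k))@_(key_mnm l r k') != 0) = (k == k').
Proof.
move=> vk vk'; rewrite raddf_sum /=.
under eq_bigr do rewrite mcoeff_sym mcoeffX; rewrite -natr_sum pnatr_eq0.
rewrite sum_nat_eq0 negb_forall; apply/existsP/eqP => [[[u v]]|<-]; last first.
  exists (1%g, 1%g) => /=; rewrite (_ : bperm 1 1 = 1%g) ?mperm1 ?eqxx //.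
  apply/permP => n; rewrite perm1 -[n]splitK; case: (split n) => a;
  by rewrite ?bpermL ?bpermR perm1.
rewrite /= eqb0 negbK => /eqP e; by apply/esym/(@valid_key_mperm l r _ _ u v).
Qed.

Definition bsym h := forall u v, msym (@bperm l r u v) h = h.

Lemma bperm_mul u v u' v' : (bperm u v * bperm u' v' = @bperm l r (u * u') (v * v'))%g.
Proof.
apply/permP => k; rewrite permM -[k]splitK; case: (split k) => a;
by rewrite ?bpermL ?bpermR permM.
Qed.

Lemma orbit_sum_bsym m : bsym (orbit_sum C m).
Proof.
move=> u v; rewrite raddf_sum /= /orbit_sum.
have inj : injective (fun uv : 'S_l * 'S_r => (uv.1 * u, uv.2 * v)%g).
  by move=> [a b] [a' b'] /= [/mulIg-> /mulIg->].
rewrite [RHS](reindex_inj inj); apply: eq_bigr => -[u' v'] _ /=.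
by rewrite -msymMm bperm_mul.
Qed.

Lemma bsym_eq0 h : bsym h ->
  (forall k, valid_key l r k -> h@_(key_mnm l r k) = 0) -> h = 0.
Proof.
move=> sh h0; apply/mpolyP => m; rewrite mcoeff0.
have [u [v [k [vk e]]]] := mperm_valid m.
by rewrite -(sh u v) mcoeff_sym e h0.
Qed.

Lemma evrelB P Q h h' : evrel P h -> evrel Q h' -> evrel (P - Q) (h - h').
Proof.
move=> Ph Qh z z_nz z_inj; rewrite rmorphB /= mulrBr Ph // Qh //.
by rewrite -mevalB mulrBr.
Qed.

Lemma evrel_sum (s : seq (seq nat * seq nat)) (c : seq nat * seq nat -> C)
    (F : seq nat * seq nat -> T) (H : seq nat * seq nat -> {mpoly C[N]}) :
  (forall k, k \in s -> evrel (F k) (H k)) ->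
  evrel (\sum_(k <- s) (c k)%:MP *: F k) (\sum_(k <- s) c k *: H k).
Proof.
move=> FH z z_nz z_inj; rewrite rmorph_sum /= !mulr_sumr rmorph_sum /=.
rewrite [LHS]big_seq [RHS]big_seq; apply: eq_bigr => k ks.
by rewrite ev2Z mevalC mulrCA FH // -scalerAr mevalZ.
Qed.

Lemma evrel0_eq0 h : evrel (0 : T) h -> h = 0.
Proof.
move=> h0; pose D := vfactor C l r * (vdm C N * \prod_(k < N) 'X_k).
have D_nz : D != 0 by rewrite !mulf_neq0 ?vfactor_neq0 ?vdm_neq0 ?prodX_neq0.
apply: (mpoly_eq_dense D_nz) => z; rewrite !mevalM !mulf_eq0 !negb_or.
case/and3P => Kz /meval_vdm_neq0 z_inj /meval_prodX_neq0 z_nz; apply: (mulfI Kz).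
by rewrite -mevalM -h0 // rmorph0 meval0 !mulr0.
Qed.

Lemma W_add P Q : W P -> W Q -> W (P + Q).
Proof.
case=> [[skP dP sP] mP] [[skQ dQ sQ] mQ]; split; [split|].
- by move=> s; rewrite msymD skP skQ scalerDr.
- by move=> m a /msuppD_le; rewrite mem_cat => /orP[/dP|/dQ]; apply.
- by move=> m; rewrite mcoeffD; apply/issymP => s; rewrite msymD !(issymP _ _).
- move=> x z a b c la bN cN xa xz zz; rewrite mevalD mevalD.
  by rewrite (mP x z a b c) // (mQ x z a b c) // addr0.
Qed.

Lemma W_scale (c : C) P : W P -> W (c%:MP *: P).
Proof.
case=> [[skP dP sP] mP]; split; [split|].
- by move=> s; rewrite msymZ skP scalerA mulrC -scalerA.
- by move=> m a /msuppZ_le/dP; apply.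
- move=> m; rewrite mcoeffZ mul_mpolyC; apply/issymP => s.
  by rewrite msymZ (issymP _ (sP m)).
- move=> x z a b c' la bN cN xa xz zz; rewrite mevalZ mevalM.
  by rewrite (mP x z a b c') // mulr0.
Qed.

Lemma W_zero : W (0 : T).
Proof.
split; [split|].
- by move=> s; rewrite msym0 scaler0.
- by move=> m a; rewrite msupp0.
- by move=> m; rewrite mcoeff0; apply/issymP => s; rewrite msym0.
- by move=> x z a b c *; rewrite !meval0.
Qed.

Lemma W_sum (s : seq (seq nat * seq nat)) (c : seq nat * seq nat -> C)
    (F : seq nat * seq nat -> T) :
  (forall k, k \in s -> W (F k)) -> W (\sum_(k <- s) (c k)%:MP *: F k).
Proof.
move=> WF; rewrite big_seq; elim/big_ind: _ => [|P Q|k /WF].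
- exact: W_zero.
- exact: W_add.
- exact: W_scale.
Qed.

Definition Wbasis k : T := projT1 (boolp.cid (alt_sum_dvd C (key_mnm l r k))).

Lemma WbasisP k : vdm C N *: Wbasis k = alt_sum C (key_mnm l r k).
Proof. by rewrite /Wbasis; case: boolp.cid. Qed.

Lemma Wbasis_W k : W (Wbasis k).
Proof. split; [exact: quotient_Cspace (WbasisP k)|exact: quotient_minimal (WbasisP k)]. Qed.

(** Passing to the quotients by V gives a linear relation between orbit sums, where each sorted
    exponent occurs in one term only. *)
Lemma Wbasis_free (s : seq (seq nat * seq nat)) (c : seq nat * seq nat -> C) :
    uniq s -> all (valid_key l r) s ->
    \sum_(k <- s) (c k)%:MP *: Wbasis k = 0 ->
  forall k, k \in s -> c k = 0.
Proof.
move=> us /allP vs s0 k ks.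
have := @evrel_sum s c Wbasis (fun k => orbit_sum C (key_mnm l r k))
  (fun k _ => quotient_evrel (WbasisP k)).
rewrite s0 => /evrel0_eq0/(congr1 (mcoeff (key_mnm l r k))).
rewrite mcoeff0 raddf_sum /= (big_rem k) //= big_seq big1 ?addr0 => [/eqP|k'].
  rewrite mcoeffZ mulf_eq0 => /orP[/eqP//|/eqP e].
  by have := orbit_sum_coeff (vs k ks) (vs k ks); rewrite e !eqxx.
rewrite mem_rem_uniq // => /andP[ne_k k's]; rewrite mcoeffZ.
have := orbit_sum_coeff (vs k' k's) (vs k ks); rewrite (negPf ne_k) => /negbFE/eqP->.
by rewrite mulr0.
Qed.

(** The combination is chosen so that its quotient by V agrees with h on sorted exponents, hence
    everywhere by invariance; the difference with P then has zero values on the grid. *)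
Lemma Wbasis_span P : W P ->
  exists (s : seq (seq nat * seq nat)) (c : seq nat * seq nat -> C),
    [/\ uniq s, all (valid_key l r) s & P = \sum_(k <- s) (c k)%:MP *: Wbasis k].
Proof.
move=> WP; have [h [Ph sh]] := evrel_exists WP.
pose s := undup [seq k <- [seq mnm_key m | m <- msupp h] | valid_key l r k].
(* The divisor is the order of a stabiliser, nonzero but in general not 1. *)
pose c k := h@_(key_mnm l r k) / (orbit_sum C (key_mnm l r k))@_(key_mnm l r k).
exists s, c; split; first exact: undup_uniq.
  by rewrite all_undup filter_all.
have vs k : k \in s -> valid_key l r k by rewrite mem_undup mem_filter => /andP[].
have Wsum : W (\sum_(k <- s) (c k)%:MP *: Wbasis k).
  by apply: W_sum => k _; apply: Wbasis_W.
apply/eqP; rewrite -subr_eq0; apply/eqP/evrel_inj.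
  have : W (P - \sum_(k <- s) (c k)%:MP *: Wbasis k).
    by rewrite -scaleN1r -mpolyC1 -mpolyCN; apply: W_add => //; apply: W_scale.
  by case.
have Phs := evrelB Ph (@evrel_sum s c Wbasis (fun k => orbit_sum C (key_mnm l r k))
  (fun k _ => quotient_evrel (WbasisP k))).
rewrite (_ : h - _ = 0) in Phs; first exact: Phs.
apply: bsym_eq0 => [u v|k vk].
  rewrite msymB sh; congr (_ + - _); rewrite raddf_sum /=; apply: eq_bigr => k _.
  by rewrite msymZ orbit_sum_bsym.
rewrite mcoeffB raddf_sum /=; apply/eqP; rewrite subr_eq0; apply/eqP.
have other k' : k' \in s -> k' != k ->
    (c k' *: orbit_sum C (key_mnm l r k'))@_(key_mnm l r k) = 0.
  move=> /vs vk' ne_k; rewrite mcoeffZ.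
  have := orbit_sum_coeff vk' vk; rewrite (negPf ne_k) => /negbFE/eqP->.
  by rewrite mulr0.
have [ks|ks] := boolP (k \in s).
  rewrite (big_rem k) //= big_seq big1 ?addr0 => [|k'].
    by rewrite mcoeffZ divfK // orbit_sum_coeff.
  by rewrite mem_rem_uniq ?undup_uniq // => /andP[ne_k k's]; apply: other.
rewrite big_seq big1 => [|k' k's].
  apply/eqP; rewrite mcoeff_eq0; apply: contra ks => km.
  rewrite mem_undup mem_filter vk; apply/mapP; exists (key_mnm l r k) => //.
  by case/and4P: vk => /eqP e1 /eqP e2 _ _; rewrite key_mnmK.
by apply: other => //; apply: contraNneq ks => <-.
Qed.

End BasisOfW.

(** * Characters from homogeneous bases *)

Section HomogeneousBasis.
Variables (C : fieldType) (I : eqType) (B : I -> {freeg monomial / C}).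
Variables (good : pred I) (beta : I -> rat * int).
Variable V : classical_sets.set {freeg monomial / C}.
Implicit Types (s : seq I) (c : I -> C).

Definition comb s c := \sum_(k <- s) c k *: B k.

Lemma comb_widen s s' c : uniq s -> uniq s' -> {subset s <= s'} ->
  comb s c = comb s' (fun k => if k \in s then c k else 0).
Proof.
move=> us us' ss'; rewrite /comb; under [RHS]eq_bigr do
  rewrite (fun_if (fun x => x *: B _)) scale0r.
rewrite -big_mkcond -big_filter; apply: perm_big; apply: uniq_perm => //.
  exact: filter_uniq.
by move=> k; rewrite mem_filter andb_idr // => /ss'.
Qed.

Lemma combD s1 c1 s2 c2 : uniq s1 -> uniq s2 -> exists c,
  comb s1 c1 + comb s2 c2 = comb (undup (s1 ++ s2)) c.
Proof.
move=> u1 u2; rewrite (comb_widen c1 u1 (undup_uniq (s1 ++ s2))); last first.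
  by move=> k ks; rewrite mem_undup mem_cat ks.
rewrite (comb_widen c2 u2 (undup_uniq (s1 ++ s2))); last first.
  by move=> k ks; rewrite mem_undup mem_cat ks orbT.
rewrite /comb -big_split /=; eexists (fun k => _ + _).
by apply: eq_bigr => k _; rewrite -scalerDl.
Qed.

Hypothesis spanV : forall F, V F <-> exists s c, [/\ uniq s, all good s & F = comb s c].
Hypothesis homB : forall k kappa, good k -> coeff kappa (B k) != 0 ->
  bidegree kappa = beta k.

Lemma coeff_comb kappa s c :
  coeff kappa (comb s c) = \sum_(k <- s) c k * coeff kappa (B k).
Proof. by rewrite raddf_sum /=; apply: eq_bigr => k _; rewrite coeffZ. Qed.

Lemma coeff_comb_eq0 kappa s c : all good s ->
  (forall k, k \in s -> beta k != bidegree kappa) -> coeff kappa (comb s c) = 0.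
Proof.
move=> /allP gs bs; rewrite coeff_comb big_seq big1 // => k ks.
have [->|nz] := eqVneq (coeff kappa (B k)) 0; first by rewrite mulr0.
by have := bs k ks; rewrite (homB (gs k ks) nz) eqxx.
Qed.

Lemma basis_bigraded : bigraded V.
Proof.
move=> F /spanV[s [c [us /allP gs ->]]]; exists [seq c k *: B k | k <- s].
rewrite big_map; split=> // _ /mapP[k ks ->]; exists (beta k).1, (beta k).2; split.
  apply/spanV; exists [:: k], c; rewrite /comb big_seq1 /= gs //.
move=> kappa; rewrite coeffZ mulf_eq0 negb_or => /andP[_ /(homB (gs k ks))->].
by rewrite -surjective_pairing.
Qed.

Hypothesis freeB : forall s c, uniq s -> all good s -> comb s c = 0 ->
  forall k, k \in s -> c k = 0.

Lemma basis_has_dim d m (S : seq I) : uniq S ->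
    (forall k, (k \in S) = good k && (beta k == (d, m))) ->
  has_dim (piece V d m) (size S).
Proof.
move=> uS memS; exists (fun i => B (tnth (in_tuple S) i)).
have gS : all good S by apply/allP => k; rewrite memS => /andP[].
have tS_inj : injective (tnth (in_tuple S)) by apply/tuple_uniqP.
pose ext (c : 'I_(size S) -> C) k := \sum_(i | tnth (in_tuple S) i == k) c i.
have extE (c : 'I_(size S) -> C) i : ext c (tnth (in_tuple S) i) = c i.
  by rewrite /ext (eq_bigl (pred1 i)) ?big_pred1_eq // => j; rewrite (inj_eq tS_inj).
have combE (c : 'I_(size S) -> C) :
    \sum_i c i *: B (tnth (in_tuple S) i) = comb S (ext c).
  by rewrite /comb [RHS]big_tnth; apply: eq_bigr => i _; rewrite extE.
split=> [c|F].
  rewrite combE => c0 i; rewrite -extE; apply: (freeB uS gS c0).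
  exact: mem_tnth.
split=> [[/spanV[s [c [us gs ->]]] homF]|[c ->]]; last first.
  rewrite combE; split; first by apply/spanV; exists S, (ext c).
  move=> kappa; apply: contra_neqP => ne; apply: coeff_comb_eq0 => // k.
  by rewrite memS => /andP[_ /eqP->]; apply/eqP => e; apply: ne.
pose s1 := [seq k <- s | beta k == (d, m)]; pose s2 := [seq k <- s | beta k != (d, m)].
have /allP gs' := gs.
have split_s : comb s c = comb s1 c + comb s2 c.
  by rewrite /comb !big_filter (bigID (fun k => beta k == (d, m))).
(* A monomial of bidegree other than (d, m) has coefficient 0 in the whole combination and in the
   part over [s1], hence in the part over [s2]; no other monomial occurs in the latter. *)
have s2_0 : comb s2 c = 0.
  apply/eqP/freeg_eqP => kappa; rewrite coeff0.
  have [e|ne] := eqVneq (bidegree kappa) (d, m).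
    apply: coeff_comb_eq0; first by apply/allP => k; rewrite mem_filter => /andP[_ /gs'].
    by move=> k; rewrite mem_filter e => /andP[].
  have : coeff kappa (comb s c) = 0.
    by apply/eqP; apply: contraNT ne => /homF->.
  rewrite split_s coeffD [X in X + _]coeff_comb_eq0 ?add0r //.
    by apply/allP => k; rewrite mem_filter => /andP[_ /gs'].
  by move=> k; rewrite mem_filter => /andP[/eqP-> _]; rewrite eq_sym.
have us1 : uniq s1 by apply: filter_uniq.
rewrite split_s s2_0 addr0 (comb_widen c us1 uS) => [|k].
  eexists; rewrite /comb big_tnth; reflexivity.
by rewrite memS mem_filter => /andP[-> /gs'->].
Qed.

End HomogeneousBasis.

Lemma sum_pred1_uniq (U : nmodType) (I : eqType) (s : seq I) x (F : I -> U) :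
  uniq s -> \sum_(k <- s | k == x) F k = if x \in s then F x else 0.
Proof.
move=> us; rewrite -big_filter; case: ifP => xs.
  by rewrite (filter_pred1_uniq us xs) big_seq1.
rewrite (eq_in_filter (a2 := pred0)) ?filter_pred0 ?big_nil // => k ks.
by apply/eqP => e; rewrite -e ks in xs.
Qed.

(** * Twisted elements in the free module on monomials *)

Section Twist.
Variables (C : numFieldType) (L : rat).

Lemma hatmonomial_inj N l (a a' : 'X_{1..l}) (b b' : 'X_{1..N}) :
  hatmonomial L a b = hatmonomial L a' b' -> a = a' /\ b = b'.
Proof.
case=> /eq_in_map ea /eq_in_map eb; split; apply/mnmP => k.
  by apply: ea; rewrite mem_enum.
have /addIr/eqP := eb k (mem_enum _ _).
by rewrite eqr_nat => /eqP.
Qed.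

Section Fixed.
Variables (N l : nat).
Implicit Types P : {mpoly {mpoly C[N]}[l]}.

Lemma coeff_twistE kappa P : coeff kappa (twist L P) =
  \sum_(a <- msupp P) \sum_(b <- msupp P@_a) P@_a@_b * (hatmonomial L a b == kappa)%:R.
Proof.
rewrite raddf_sum /=; apply: eq_bigr => a _; rewrite raddf_sum /=; apply: eq_bigr => b _.
by rewrite coeffU.
Qed.

Lemma coeff_twist P a b : coeff (hatmonomial L a b) (twist L P) = P@_a@_b.
Proof.
rewrite coeff_twistE.
transitivity (\sum_(a' <- msupp P | a' == a) \sum_(b' <- msupp P@_a' | b' == b) P@_a'@_b').
  rewrite [RHS]big_mkcond; apply: eq_bigr => a' _.
  rewrite [in RHS]big_mkcond; case: eqP => [->|ne_a].
    apply: eq_bigr => b' _; case: (eqVneq b' b) => [->|ne_b].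
      by rewrite eqxx mulr1.
    case: eqP => [/hatmonomial_inj[_ e]|_]; last by rewrite mulr0.
    by rewrite e eqxx in ne_b.
  apply: big1 => b' _; case: eqP => [/hatmonomial_inj[]//|_]; by rewrite mulr0.
rewrite sum_pred1_uniq ?msupp_uniq //; case: ifP => [_|/negbT].
  rewrite sum_pred1_uniq ?msupp_uniq //; case: ifP => // /negbT.
  by rewrite -mcoeff_eq0 => /eqP.
by rewrite -mcoeff_eq0 => /eqP->; rewrite mcoeff0.
Qed.

Lemma coeff_twist_neq0 kappa P : coeff kappa (twist L P) != 0 ->
  exists (a : 'X_{1..l}) (b : 'X_{1..N}), kappa = hatmonomial L a b.
Proof.
have [[[a b] ->]|nex] := boolp.pselect
    (exists ab : ('X_{1..l} * 'X_{1..N})%type, kappa = hatmonomial L ab.1 ab.2).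
  by exists a, b.
rewrite coeff_twistE big1 ?eqxx // => a _; apply: big1 => b _.
case: eqP => [e|_]; last by rewrite mulr0.
by case: nex; exists (a, b).
Qed.

Lemma twist_sum (I : eqType) (s : seq I) (c : I -> C) (F : I -> {mpoly {mpoly C[N]}[l]}) :
  twist L (\sum_(k <- s) (c k)%:MP *: F k) = \sum_(k <- s) c k *: twist L (F k).
Proof.
apply/eqP/freeg_eqP => kappa; rewrite [RHS]raddf_sum /=.
have [[[a b] ->]|nex] := boolp.pselect
    (exists ab : ('X_{1..l} * 'X_{1..N})%type, kappa = hatmonomial L ab.1 ab.2).
  rewrite coeff_twist !raddf_sum /=; apply: eq_bigr => k _.
  by rewrite coeffZ coeff_twist mcoeffZ mcoeffCM.
have out P : coeff kappa (twist L P) = 0.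
  apply/eqP; apply: contra_notT nex => /coeff_twist_neq0[a [b e]].
  by exists (a, b).
by rewrite out big1 // => k _; rewrite coeffZ out mulr0.
Qed.

End Fixed.
End Twist.

Section HatW.
Variables (C : numFieldType) (L : rat) (p : nat).
Implicit Types (k : seq nat * seq nat).

Definition hatbasis k : {freeg monomial / C} :=
  twist L (Wbasis C (size k.1) (size k.2) k).

Definition good_key k :=
  [&& sorted leq k.1, sorted leq k.2 & size k.1 + size k.2 == p %[mod 2]].

(** P has degree equal to the total size of the two partitions, and (z_1 ... z_N)^(-L) lowers it by
    N L. *)
Definition key_bidegree k : rat * int :=
  let N := (size k.1 + size k.2)%N in
  (- (N%:R ^+ 2 / 4 - N%:R * L + (sumn k.1 + sumn k.2)%:R), N%:Z - 2 * (size k.1)%:Z).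

Lemma bidegree_hatmonomial N l (a : 'X_{1..l}) (b : 'X_{1..N}) :
  bidegree (hatmonomial L a b) =
  (- (N%:R ^+ 2 / 4 - N%:R * L + (mdeg b)%:R - (mdeg a)%:R), N%:Z - 2 * l%:Z).
Proof.
rewrite /bidegree !size_map -!enumT !size_enum_ord /= !big_map -!enumT !big_enum /=.
congr (- _, _); rewrite sumrB sumr_const card_ord !mdegE !natr_sum -mulr_natl.
by ring.
Qed.

Lemma hatbasis_homog k kappa : good_key k -> coeff kappa (hatbasis k) != 0 ->
  bidegree kappa = key_bidegree k.
Proof.
move=> gk nz; have [a [b e]] := coeff_twist_neq0 nz.
move: nz; rewrite e coeff_twist -mcoeff_msupp => /(quotient_homog (WbasisP C _ _ k)).
rewrite mdeg_key_mnm // => eb; rewrite bidegree_hatmonomial eb /key_bidegree.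
by congr (- _, _); rewrite natrD; ring.
Qed.

Lemma hatbasisE l r k : size k.1 = l -> size k.2 = r ->
  hatbasis k = twist L (Wbasis C l r k).
Proof. by move=> <- <-. Qed.

Lemma hatbasis_sum l r s (c : _ -> C) : all (valid_key l r) s ->
  twist L (\sum_(k <- s) (c k)%:MP *: Wbasis C l r k) = comb hatbasis s c.
Proof.
move=> /allP vs; rewrite twist_sum /comb !big_seq; apply: eq_bigr => k ks.
by have /and4P[/eqP e1 /eqP e2 _ _] := vs k ks; rewrite (hatbasisE e1 e2).
Qed.

Lemma coeff_hatbasis_size k N l (a : 'X_{1..l}) (b : 'X_{1..N}) :
  coeff (hatmonomial L a b) (hatbasis k) != 0 ->
  size k.1 = l /\ (size k.1 + size k.2 = N)%N.
Proof.
move=> /coeff_twist_neq0[a' [b' [e1 e2]]].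
by have := congr1 size e1; have := congr1 size e2; rewrite !size_map -!enumT !size_enum_ord.
Qed.

(** Keys with different (l, r) give elements with disjoint supports, so a relation splits into
    relations inside the single spaces W_(N,l). *)
Lemma hatbasis_free s c : uniq s -> all good_key s -> comb hatbasis s c = 0 ->
  forall k, k \in s -> c k = 0.
Proof.
move=> us /allP gs c0 k0 k0s; pose l := size k0.1; pose r := size k0.2.
pose s' := [seq k <- s | valid_key l r k].
apply: (@Wbasis_free C l r s') => //; first exact: filter_uniq.
- exact: filter_all.
- apply/mpolyP => a; apply/mpolyP => b; rewrite !mcoeff0.
  rewrite -(coeff_twist L) hatbasis_sum ?filter_all //.
  rewrite -[RHS](coeff0 C (hatmonomial L a b)) -c0 /comb !raddf_sum /=.
  rewrite big_filter big_mkcond.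
  rewrite big_seq [RHS]big_seq; apply: eq_bigr => k ks; case: ifP => // /negbT vk.
  rewrite coeffZ; have [->|/coeff_hatbasis_size[e1 e2]] :=
    eqVneq (coeff (hatmonomial L a b) (hatbasis k)) 0; first by rewrite mulr0.
  case/negP: vk; have /and3P[s1 s2 _] := gs k ks; apply/and4P; split=> //.
    by rewrite e1.
  by move: e2; rewrite e1 => /addnI->.
- rewrite mem_filter k0s andbT; have /and3P[s1 s2 _] := gs k0 k0s.
  by apply/and4P; split.
Qed.

Lemma hatW_comb N l F : (l <= N)%N -> hatW N l L F -> exists s (c : _ -> C),
  [/\ uniq s, all (valid_key l (N - l)) s & F = comb hatbasis s c].
Proof.
move=> le_lN; rewrite -{1}(subnKC le_lN); move: (N - l)%N => r {N le_lN}.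
case=> P WP <-; have [s [c [us vs ->]]] := Wbasis_span WP.
by exists s, c; split=> //; rewrite hatbasis_sum.
Qed.

Lemma comb_hatW l r s (c : _ -> C) : all (valid_key l r) s ->
  hatW (l + r) l L (comb hatbasis s c).
Proof.
move=> vs; exists (\sum_(k <- s) (c k)%:MP *: Wbasis C l r k).
  by apply: W_sum => k _; apply: Wbasis_W.
exact: hatbasis_sum.
Qed.

Definition spanned (F : {freeg monomial / C}) := exists s c,
  [/\ uniq s, all good_key s & F = comb hatbasis s c].

Lemma spannedD F G : spanned F -> spanned G -> spanned (F + G).
Proof.
case=> s1 [c1 [u1 g1 ->]] [s2 [c2 [u2 g2 ->]]].
have [c ->] := combD hatbasis c1 c2 u1 u2.
exists (undup (s1 ++ s2)), c; split; rewrite ?undup_uniq //.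
by rewrite all_undup all_cat g1.
Qed.

Lemma hatW_sum_spanned F : hatW_sum C L p F -> spanned F.
Proof.
case=> M [G [WG ->]].
have spanned0 : spanned 0 by exists [::], (fun=> 0); rewrite /comb big_nil.
apply: big_ind => // [|N /eqP Np]; first exact: spannedD.
apply: big_ind => // [|l _]; first exact: spannedD.
have le_lN : (l <= N)%N by rewrite -ltnS.
have [s [c [us /allP vs ->]]] := hatW_comb le_lN (WG N l Np le_lN).
exists s, c; split=> //; apply/allP => k /vs/and4P[/eqP e1 /eqP e2 s1 s2].
by rewrite /good_key s1 s2 e1 e2 subnKC // Np eqxx.
Qed.

Lemma spanned_hatW_sum F : spanned F -> hatW_sum C L p F.
Proof.
case=> s [c [us /allP gs ->]].
pose sz k := (size k.1 + size k.2)%N.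
exists (\max_(k <- s) sz k).+1.
exists (fun N l => comb hatbasis [seq k <- s | (size k.1 == l) && (sz k == N)] c).
split=> [N l _ le_lN|].
  rewrite -{1}(subnKC le_lN); apply: comb_hatW; apply/allP => k.
  rewrite mem_filter => /andP[/andP[/eqP e1 /eqP e2] /gs/and3P[s1 s2 _]].
  by apply/and4P; split; rewrite ?e1 // -e2 /sz e1 addKn.
have in_max k : k \in s -> (sz k < (\max_(k <- s) sz k).+1)%N.
  by move=> ks; rewrite ltnS; apply: leq_bigmax_seq.
pose X k (N l : nat) : {freeg monomial / C} :=
  if (size k.1 == l) && (sz k == N) then c k *: hatbasis k else 0.
transitivity (\sum_(k <- s) \sum_(N < (\max_(k <- s) sz k).+1 | N == p %[mod 2])
                \sum_(l < N.+1) X k N l).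
  rewrite /comb [LHS]big_seq [RHS]big_seq; apply: eq_bigr => k ks.
  have /and3P[_ _ kp] := gs k ks.
  have lt_k : (size k.1 < (sz k).+1)%N by rewrite ltnS leq_addr.
  rewrite (bigD1 (Ordinal (in_max k ks))) //= (bigD1 (Ordinal lt_k)) //=.
  rewrite /X !eqxx /= !big1 ?addr0 // => [N|l].
    case/andP=> _; rewrite -(inj_eq val_inj) /= eq_sym => /negPf neN.
    by apply: big1 => l _; rewrite neN andbF.
  by rewrite -(inj_eq val_inj) /= eq_sym => /negPf->.
rewrite exchange_big; apply: eq_bigr => N _ /=.
rewrite [LHS]exchange_big; apply: eq_bigr => l _ /=.
by rewrite /comb big_filter [RHS]big_mkcond.
Qed.

Lemma hatW_sumP F : hatW_sum C L p F <-> spanned F.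
Proof. by split; [apply: hatW_sum_spanned|apply: spanned_hatW_sum]. Qed.

Lemma hatW_sum_character (f : qz_series) (S : rat -> int -> seq (seq nat * seq nat)) :
    (forall d m, uniq (S d m)) ->
    (forall d m k, (k \in S d m) = good_key k && (key_bidegree k == (d, m))) ->
    (forall d m, f d m = (size (S d m))%:R) ->
  has_character (hatW_sum C L p) f.
Proof.
move=> uS memS fS; split.
  exact: (basis_bigraded hatW_sumP hatbasis_homog).
move=> d m; exists (size (S d m)); split=> //.
exact: (basis_has_dim hatW_sumP hatbasis_homog hatbasis_free).
Qed.

End HatW.

(** * Durfee rectangles *)

(** Lists the increasing, zero-padded partitions of e with a entries: c is the least entry, at most
    e / a, and is subtracted from all of them. *)
Fixpoint parts (a : nat) (e : nat) : seq (seq nat) :=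
  if a is a'.+1 then
    [seq c :: map (addn c) s | c <- iota 0 (e %/ a).+1, s <- parts a' (e - a * c)]
  else if e is 0%N then [:: [::]] else [::].

Lemma sumn_map_addn c s : sumn (map (addn c) s) = (size s * c + sumn s)%N.
Proof. by elim: s => //= x s ->; nia. Qed.

Lemma sorted_map_addn c s : sorted leq (map (addn c) s) = sorted leq s.
Proof. by rewrite sorted_map; apply: eq_sorted => x y /=; rewrite leq_add2l. Qed.

Lemma partsS a e : parts a.+1 e =
  [seq c :: map (addn c) s | c <- iota 0 (e %/ a.+1).+1, s <- parts a (e - a.+1 * c)].
Proof. by []. Qed.

Lemma mem_parts a e s :
  (s \in parts a e) = [&& size s == a, sorted leq s & sumn s == e].
Proof.
elim: a e s => [|a IH] e s.
  by case: e s => [|e] [|x s] //=; rewrite ?andbF.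
rewrite partsS; apply/allpairsPdep/and3P => [[c [t []]]|].
  rewrite mem_iota IH /= ltnS => c_le /and3P[/eqP szt st /eqP sumt] ->.
  rewrite /= size_map szt path_sortedE; last exact: leq_trans.
  rewrite sorted_map_addn st andbT eqxx sumn_map_addn szt sumt; split=> //.
    by apply/allP => _ /mapP[x _ ->]; apply: leq_addr.
  have : (c * a.+1 <= e)%N by rewrite -leq_divRL.
  by nia.
case: s => [[]|c s [szs ps sums]] //.
rewrite [size _]/= in szs; rewrite [sorted _ _]/= in ps; rewrite [sumn _]/= in sums.
move: ps; rewrite path_sortedE; last exact: leq_trans.
case/andP => cs ss; pose t := map (subn^~ c) s.
have es : s = map (addn c) t.
  rewrite -map_comp -[LHS]map_id; apply/eq_in_map => x xs /=.
  by rewrite subnKC // (allP cs).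
exists c, t; split; last by rewrite -es.
  rewrite mem_iota /= add0n ltnS leq_divRL // -(eqP sums) es sumn_map_addn size_map.
  by move: szs => /eqP[<-]; nia.
rewrite IH size_map; move: szs sums; rewrite eqSS => /eqP szs /eqP <-.
rewrite szs eqxx -(sorted_map_addn c) -es ss /= es sumn_map_addn size_map szs.
by apply/eqP; nia.
Qed.

Lemma uniq_parts a e : uniq (parts a e).
Proof.
elim: a e => [|a IH] e; first by case: e.
rewrite partsS; apply: allpairs_uniq_dep => [|c _|]; rewrite ?iota_uniq //.
move=> [c s] [c' s'] _ _ /= [<-] /(inj_map (@addnI c))->; by [].
Qed.

(** The two summands count partitions with least entry zero and with all entries positive. In
    series, (1 - q^(a+1)) / (q)_(a+1) = 1 / (q)_a. *)
Lemma size_parts_rec a e : size (parts a.+1 e) =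
  (size (parts a e) + if a < e then size (parts a.+1 (e - a.+1)) else 0)%N.
Proof.
rewrite !partsS !size_allpairs_dep.
have -> : iota 0 (e %/ a.+1).+1 = 0%N :: map succn (iota 0 (e %/ a.+1)).
  by rewrite /= (iotaDl 1 0).
case: ifP => [le_ae|/negbT]; last first.
  by rewrite -leqNgt => lt_ea; rewrite divn_small //= muln0 subn0.
have -> : ((e - a.+1) %/ a.+1).+1 = (e %/ a.+1)%N.
  by rewrite -{2}(subnK le_ae) divnDr // divnn addn1.
rewrite map_cons /= muln0 subn0 -map_comp; congr (_ + sumn _)%N.
by apply: eq_map => c /=; rewrite mulnS subnDA.
Qed.

Definition cpair (a b e : nat) : nat :=
  (\sum_(i < e.+1) size (parts a i) * size (parts b (e - i)))%N.

Lemma cpairC a b e : cpair a b e = cpair b a e.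
Proof.
rewrite /cpair (reindex_inj rev_ord_inj); apply: eq_bigr => i _ /=.
have le_ie : (i <= e)%N by rewrite -ltnS.
by rewrite subSS subKn // mulnC.
Qed.

Lemma cpair_rec a b e : cpair a.+1 b e =
  (cpair a b e + if a < e then cpair a.+1 b (e - a.+1) else 0)%N.
Proof.
rewrite /cpair; under eq_bigr do rewrite size_parts_rec mulnDl.
rewrite big_split; congr addn => /=.
case: ltnP => [lt_ae|le_ea]; last first.
  apply: big1 => i _; rewrite ltnNge (leq_trans _ le_ea) //.
  by rewrite -ltnS.
rewrite -(big_mkord xpredT (fun i =>
  (if a < i then size (parts a.+1 (i - a.+1)) else 0) * size (parts b (e - i))))%N.
rewrite -(big_mkord xpredT (fun i =>
  size (parts a.+1 i) * size (parts b (e - a.+1 - i))))%N.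
rewrite (big_cat_nat (n := a.+1)) ?(leq_trans lt_ae) //=.
rewrite big_nat big1 => [|i /andP[_ lt_ia]]; last by rewrite ltnNge -ltnS lt_ia.
rewrite add0n -{1}(add0n a.+1) big_addn subSn //.
apply: eq_bigr => i _; have -> : (a < i + a.+1)%N by lia.
by rewrite addnK -subnDA [(a.+1 + i)%N]addnC.
Qed.

(* The coefficient of q^E in 1 / ((q)_a (q)_b), zero for negative arguments. *)
Definition pair_count (a b E : int) : rat :=
  if (a, b, E) is (Posz a, Posz b, Posz e) then (cpair a b e)%:R else 0.

Lemma pair_count_symm a b E : pair_count a b E = pair_count b a E.
Proof. by case: a b E => a [] b [] e; rewrite /pair_count // cpairC. Qed.

Lemma pair_count_neg a b E : (a < 0) || (b < 0) || (E < 0) -> pair_count a b E = 0.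
Proof. by case: a b E => a [] b [] e. Qed.

(** (1 - q^a) / (q)_a = 1 / (q)_(a-1), valid for every integer a when 1 / (q)_n is read as 0 for n <
    0. Thus no boundary terms arise in the sums below. *)
Lemma pair_count_recl a b E :
  pair_count a b E = pair_count (a - 1) b E + pair_count a b (E - a).
Proof.
have [ab_lt0|] := boolP ((a < 0) || (b < 0)).
  by rewrite !pair_count_neg ?addr0 //; lia.
rewrite negb_or -!leNgt; case: a b => a // [] b // _.
case: E => e; last by rewrite !pair_count_neg ?addr0 //; lia.
case: a => [|a]; first by rewrite subr0 [in X in X + _]pair_count_neg ?add0r.
rewrite (_ : a.+1%:Z - 1 = a); last by lia.
rewrite {1 2}/pair_count cpair_rec natrD; congr (_ + _).
case: ltnP => [lt_ae|le_ea]; last by rewrite pair_count_neg //; lia.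
by rewrite (_ : e%:Z - a.+1%:Z = (e - a.+1)%N%:Z) //; lia.
Qed.

Lemma pair_count_recr a b E :
  pair_count a b E = pair_count a (b - 1) E + pair_count a b (E - b).
Proof.
rewrite pair_count_symm pair_count_recl pair_count_symm.
by rewrite [pair_count b a _]pair_count_symm.
Qed.

Definition durfee_term (M : nat) (m E : int) (a : nat) : rat :=
  pair_count a (a%:Z + m) (E - a%:Z * (a%:Z + m - M%:Z)).

(** From this index on the exponent a(a + m - M) exceeds E, so the infinite sum is finite in each
    degree. *)
Definition durfee_bound (M : nat) (m E : int) : nat := (`|E| + `|m| + M).+1.

Definition durfee_sum M m E : rat :=
  \sum_(0 <= a < durfee_bound M m E) durfee_term M m E a.

Lemma durfee_bound_lt M m E (a : nat) : (durfee_bound M m E <= a)%N ->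
  E - a%:Z * (a%:Z + m - M%:Z) < 0.
Proof.
move=> le_a.
have : 1 + `|E|%:Z <= a%:Z + m - M%:Z by move: le_a; rewrite /durfee_bound; lia.
have : 1 <= a%:Z by move: le_a; rewrite /durfee_bound; lia.
by nia.
Qed.

Lemma durfee_term0 M m E a :
  (durfee_bound M m E <= a)%N -> durfee_term M m E a = 0.
Proof. by move=> /durfee_bound_lt lt0; apply: pair_count_neg; rewrite lt0 !orbT. Qed.

Lemma durfee_sumE M m E b : (durfee_bound M m E <= b)%N ->
  durfee_sum M m E = \sum_(0 <= a < b) durfee_term M m E a.
Proof.
move=> le_b; rewrite (big_cat_nat (leq0n _) le_b) /= [X in _ + X]big_nat.
by rewrite [X in _ + X]big1 ?addr0 // => a /andP[/durfee_term0].
Qed.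

(** Splits 1/(q)_a. The term in 1/(q)_(a-1) is shifted by a -> a+1, where (a+1)(a+m-M) = a(a+m+1-M)
    + m - M; in the other term the extra q^a lowers M+1 to M. *)
Lemma durfee_sum_recl M m E : durfee_sum M.+1 m E =
  durfee_sum M (m + 1) (E - m + M%:Z) + durfee_sum M m E.
Proof.
pose b := (durfee_bound M.+1 m E + durfee_bound M (m + 1) (E - m + M%:Z)
           + durfee_bound M m E)%N.
rewrite (@durfee_sumE _ _ _ b.+1); last by rewrite /b; lia.
rewrite (@durfee_sumE M (m + 1) _ b); last by rewrite /b; lia.
rewrite (@durfee_sumE M m _ b.+1); last by rewrite /b; lia.
rewrite (eq_bigr (fun a : nat =>
    pair_count (a%:Z - 1) (a%:Z + m) (E - a%:Z * (a%:Z + m - M.+1%:Z))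
    + durfee_term M m E a)) => [|a _].
  rewrite big_split /=; congr (_ + _); rewrite big_nat_recl // pair_count_neg ?add0r //.
  apply: eq_bigr => a _; rewrite /durfee_term; congr pair_count; [lia|lia|].
  by rewrite -[a.+1]addn1 -[M.+1]addn1 !PoszD; ring.
rewrite /durfee_term pair_count_recl; congr (_ + pair_count _ _ _).
by rewrite -[M.+1]addn1 PoszD; ring.
Qed.

(** Splits the other factor 1/(q)_(a+m). Comparing both recurrences at M = 0 gives the independence
    of m. *)
Lemma durfee_sum_recr M m E : durfee_sum M.+1 m E =
  durfee_sum M (m - 1) E + durfee_sum M m (E - m).
Proof.
pose b := (durfee_bound M.+1 m E + durfee_bound M (m - 1) E + durfee_bound M m (E - m))%N.
rewrite (@durfee_sumE _ _ _ b); last by rewrite /b; lia.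
rewrite (@durfee_sumE M (m - 1) _ b); last by rewrite /b; lia.
rewrite (@durfee_sumE M m (E - m) b); last by rewrite /b; lia.
rewrite -big_split /=; apply: eq_bigr => a _.
rewrite {1}/durfee_term pair_count_recr /durfee_term -[M.+1]addn1 PoszD.
by congr (pair_count _ _ _ + pair_count _ _ _); ring.
Qed.

Lemma durfee_sum_neg m E : E < 0 -> durfee_sum 0 m E = 0.
Proof.
move=> E_lt0; rewrite /durfee_sum big1 // => a _; apply: pair_count_neg.
by case: (ltP (a%:Z + m) 0) => // am; apply/orP; right; nia.
Qed.

(* By the two recurrences at M = 0 the difference of consecutive sums satisfies
   delta_(m-1)(E) = - delta_m(E - m), which forces it to vanish. *)
Lemma durfee_sum_step m E : durfee_sum 0 m E = durfee_sum 0 (m + 1) E.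
Proof.
pose delta m E := durfee_sum 0 m E - durfee_sum 0 (m + 1) E.
have rec k F : delta (k - 1) F = - delta k (F - k).
  have := durfee_sum_recl 0 k F; rewrite durfee_sum_recr /delta addr0 subrK => e.
  by apply/eqP; rewrite -addr_eq0; apply/eqP; move: e; lra.
suff d0 k F : delta k F = 0 by apply/eqP; rewrite -subr_eq0; apply/eqP/d0.
(* For k >= 0, passing from k to k+1 lowers F by k+1 >= 1, until both sums vanish. A negative k is
   then raised to 0. *)
have pos n k' F' : 0 <= k' -> F' < n%:Z -> delta k' F' = 0.
  elim: n k' F' => [|n IH] k' F' k'_ge0 F'n.
    by rewrite /delta !durfee_sum_neg ?subr0.
  have := rec (k' + 1) F'; rewrite addrK => ->; rewrite IH ?oppr0 //; lia.
have {}pos k' F' : 0 <= k' -> delta k' F' = 0 by move=> ?; apply: (pos `|F'|.+1) => //; lia.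
have neg n F' : delta (- n%:Z) F' = 0.
  elim: n F' => [|n IH] F'; first by apply: pos.
  by rewrite -[n.+1]addn1 PoszD opprD rec IH oppr0.
case: (leP 0 k) => [/pos//|k_lt0].
by have := neg `|k|%N F; rewrite (_ : - `|k|%N%:Z = k) //; lia.
Qed.

(* The coefficient of q^E in 1 / (q)_oo. *)
Definition part_count (E : int) : rat :=
  if E is Posz e then (size (parts e e))%:R else 0.

(** For E >= 0 independence of m allows m = E. The terms with a >= 1 then start in degree a(a + E) >
    E, and a = 0 leaves 1/(q)_E, which agrees with 1/(q)_oo up to degree E. *)
Lemma durfee_sum0 m E : durfee_sum 0 m E = part_count E.
Proof.
have shift n k : durfee_sum 0 k E = durfee_sum 0 (k + n%:Z) E.
  elim: n => [|n ->]; first by rewrite addr0.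
  by rewrite durfee_sum_step -addrA -PoszD addn1.
case: E shift => e shift; last exact: durfee_sum_neg.
have -> : durfee_sum 0 m e = durfee_sum 0 e e.
  case: (leP m e%:Z) => me.
    by rewrite (shift `|e%:Z - m|%N) gez0_abs; [congr durfee_sum|]; lia.
  by rewrite [RHS](shift `|m - e%:Z|%N) gez0_abs; [congr durfee_sum|]; lia.
rewrite /durfee_sum big_nat_recl // big_nat big1 => [|a _]; last first.
  by apply: pair_count_neg; rewrite orbC; apply/orP; left; nia.
rewrite addr0 /durfee_term mul0r subr0 add0r /pair_count /cpair big_ord_recl big1 => [|i _].
  by rewrite addn0 /= mul1n subn0.
by rewrite mul0n.
Qed.

(** * Gaussian binomials *)

(** Gaussian binomials by the q-Pascal rule, which suits induction better than an exact quotient.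
    The subtraction [M' - s'] truncates only when s' > M', where the other factor is 0. *)
Fixpoint gauss (M s : nat) : {poly rat} :=
  match M, s with
  | _, 0%N => 1
  | 0%N, _.+1 => 0
  | M'.+1, s'.+1 => gauss M' s + 'X^(M' - s') * gauss M' s'
  end.

Lemma gauss0 M : gauss M 0 = 1. Proof. by case: M. Qed.

Lemma gauss_gt M s : (M < s)%N -> gauss M s = 0.
Proof.
elim: M s => [|M IH] [|s] //= lt_Ms.
by rewrite !IH ?mulr0 ?addr0 // ltnW.
Qed.

Lemma qpochS n : qpoch n.+1 = qpoch n * (1 - 'X^(n.+1)).
Proof. by rewrite /qpoch big_nat_recr. Qed.

Lemma qpoch0 : qpoch 0 = 1.
Proof. by rewrite /qpoch big_geq. Qed.

Lemma qpoch_coef0 n : (qpoch n)`_0 = 1.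
Proof.
elim: n => [|n IH]; first by rewrite qpoch0 coef1.
by rewrite qpochS coef0M IH coefB coef1 coefXn subr0 mulr1.
Qed.

Lemma qpoch_neq0 n : qpoch n != 0.
Proof. by apply: contra_eq_neq (qpoch_coef0 n) => ->; rewrite coef0 eq_sym oner_eq0. Qed.

Lemma gauss_qpoch M s : (s <= M)%N ->
  gauss M s * (qpoch s * qpoch (M - s)) = qpoch M.
Proof.
elim: M s => [|M IH] [|s] //; rewrite ?gauss0 ?qpoch0 ?subn0 ?mul1r //.
rewrite ltnS subSS /= => le_sM; rewrite mulrDl.
have e2 : 'X^(M - s) * gauss M s * (qpoch s.+1 * qpoch (M - s)) =
    'X^(M - s) * (1 - 'X^(s.+1)) * qpoch M.
  by rewrite -[in RHS](IH s le_sM) qpochS; ring.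
rewrite e2; move: le_sM; rewrite leq_eqVlt => /orP[/eqP->|lt_sM].
  by rewrite gauss_gt // mul0r add0r subnn expr0 mul1r qpochS mulrC.
have e1 : gauss M s.+1 * (qpoch s.+1 * qpoch (M - s)) = (1 - 'X^(M - s)) * qpoch M.
  by rewrite -[in RHS](IH _ lt_sM) -(subnSK lt_sM) (qpochS (M - s.+1)); ring.
rewrite e1 qpochS; have -> : 'X^(M.+1) = 'X^(M - s) * 'X^(s.+1) :> {poly rat}.
  by rewrite -exprD addnS subnK // ltnW.
by ring.
Qed.

Lemma qbinomE (M s : nat) : (s <= M)%N -> qbinom M s = gauss M s.
Proof.
move=> le_sM; rewrite /qbinom lez_nat le_sM /= subzn //=.
by rewrite -[qpoch M](gauss_qpoch le_sM) mulpK // mulf_neq0 ?qpoch_neq0.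
Qed.

Definition eqX n (f g : {poly rat}) := forall k, (k < n)%N -> f`_k = g`_k.

Lemma eqXM n f f' g g' : eqX n f f' -> eqX n g g' -> eqX n (f * g) (f' * g').
Proof.
move=> ef eg k kn; rewrite !coefM; apply: eq_bigr => i _.
by rewrite ef ?eg // (leq_ltn_trans _ kn) // ?leq_subr // -ltnS.
Qed.

Lemma coef_exp_lt (f : {poly rat}) k n : f`_0 = 0 -> (k < n)%N -> (f ^+ n)`_k = 0.
Proof.
move=> f0; elim: n k => // n IH k kn; rewrite exprS coefM big1 // => -[[|i] ik] _ /=.
  by rewrite f0 mul0r.
by rewrite IH ?mulr0 //; lia.
Qed.

(** Modulo q^(n+1) both the truncated geometric series A and the generating polynomial [B n] of
    partitions are inverse to (q)_n, hence equal. *)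
Lemma inv_qpoch_infE n : inv_qpoch_inf n = (size (parts n n))%:R.
Proof.
pose A : {poly rat} := \sum_(r < n.+1) (1 - qpoch n) ^+ r.
pose B k : {poly rat} := \poly_(e < n.+1) (size (parts k e))%:R.
have AQ : eqX n.+1 (A * qpoch n) 1.
  have -> : A * qpoch n = 1 - (1 - qpoch n) ^+ n.+1.
    by rewrite -[RHS]opprB subrX1 addrAC subrr sub0r mulNr opprK mulrC.
  move=> k kn; rewrite coefB coef_exp_lt ?subr0 //.
  by rewrite coefB coef1 qpoch_coef0 subrr.
have BQ k : eqX n.+1 (B k * qpoch k) 1.
  elim: k => [|k IH].
    by rewrite qpoch0 mulr1 => k kn; rewrite coef_poly kn coef1; case: k {kn}.
  rewrite qpochS [qpoch k * _]mulrC mulrA.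
  suff eB : eqX n.+1 (B k.+1 * (1 - 'X^(k.+1))) (B k).
    move=> e en; rewrite (eqXM eB (fun _ _ => erefl)) //; exact: IH.
  move=> e en; rewrite mulrBr mulr1 coefB coefMXn !coef_poly en size_parts_rec.
  rewrite ltnS; case: leqP => [le_ek|lt_ke]; first by rewrite addn0 subr0.
  by rewrite (leq_ltn_trans (leq_subr _ _) en) natrD addrK.
have AB : eqX n.+1 A (B n).
  move=> k kn; have := @eqXM _ A A _ _ (fun _ _ => erefl) (BQ n) k kn.
  rewrite mulr1 => <-; rewrite (_ : A * (B n * qpoch n) = A * qpoch n * B n); last by ring.
  by rewrite (@eqXM _ _ _ (B n) _ AQ (fun _ _ => erefl) k kn) mul1r.
by rewrite /inv_qpoch_inf AB // coef_poly ltnSn.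
Qed.

(* The coefficient of q^E in g(q^-1) / (q)_oo. *)
Definition pairing (E : int) (g : {poly rat}) : rat :=
  \sum_(r < size g) g`_r * part_count (E + r%:Z).

Lemma pairingE b E (g : {poly rat}) : (size g <= b)%N ->
  pairing E g = \sum_(r < b) g`_r * part_count (E + r%:Z).
Proof.
move=> le_b; rewrite -(subnKC le_b) big_split_ord /= [X in _ + X]big1 ?addr0 // => i _.
by rewrite nth_default ?mul0r //= leq_addr.
Qed.

Lemma pairingD E f g : pairing E (f + g) = pairing E f + pairing E g.
Proof.
pose b := maxn (size f) (size g).
rewrite (@pairingE b _ (f + g)) ?size_polyD // (@pairingE b _ f) ?leq_maxl //.
rewrite (@pairingE b _ g) ?leq_maxr // -big_split; apply: eq_bigr => r _ /=.
by rewrite coefD mulrDl.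
Qed.

Lemma pairingXn E k g : pairing E ('X^k * g) = pairing (E + k%:Z) g.
Proof.
rewrite (@pairingE (k + size g)); last first.
  by rewrite (leq_trans (size_polyMleq _ _)) // size_polyXn.
rewrite big_split_ord /= big1 ?add0r => [|i _]; last by rewrite coefXnM ltn_ord mul0r.
apply: eq_bigr => i _; rewrite coefXnM ltnNge leq_addr /= addKn.
by rewrite PoszD addrA.
Qed.

Lemma pairing0 E : pairing E 0 = 0.
Proof. by rewrite /pairing size_poly0 big_ord0. Qed.

Definition gauss_sum M m E : rat := \sum_(s < M.+1) pairing (E - m * s%:Z) (gauss M s).

(** The q-Pascal rule in q^-1: after the shift s -> s+1, q^(m(s+1)) q^(-(M-s)) = q^(m-M)
    q^((m+1)s). *)
Lemma gauss_sum_rec M m E : gauss_sum M.+1 m E =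
  gauss_sum M (m + 1) (E - m + M%:Z) + gauss_sum M m E.
Proof.
rewrite /gauss_sum [LHS]big_ord_recl [X in _ = _ + X]big_ord_recl !gauss0.
rewrite [RHS]addrCA; congr (_ + _).
rewrite (eq_bigr (fun i : 'I_M.+1 => pairing (E - m * i.+1%:Z) (gauss M i.+1)
    + pairing (E - m + M%:Z - (m + 1) * i%:Z) (gauss M i))) => [|i _].
  rewrite big_split [RHS]addrC; congr (_ + _).
  by rewrite big_ord_recr /= (gauss_gt (ltnSn M)) pairing0 addr0.
have le_iM : (i <= M)%N by rewrite -ltnS.
rewrite lift0 [gauss M.+1 _]/= pairingD pairingXn -subzn // -[i.+1]addn1 PoszD.
by congr (_ + pairing _ _); ring.
Qed.

Lemma durfee_gauss M m E : durfee_sum M m E = gauss_sum M m E.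
Proof.
elim: M m E => [|M IH] m E; last by rewrite durfee_sum_recl gauss_sum_rec !IH.
rewrite durfee_sum0 /gauss_sum big_ord1 /= mulr0 subr0 /pairing size_poly1 big_ord1.
by rewrite coef1 mul1r addr0.
Qed.

(** * The character *)

Lemma uniq_flatten_sep (T1 T2 : eqType) (s : seq T1) (F : T1 -> seq T2) (g : T2 -> T1) :
    uniq s -> (forall x, uniq (F x)) -> (forall x y, y \in F x -> g y = x) ->
  uniq (flatten [seq F x | x <- s]).
Proof.
move=> + uF gF; elim: s => //= x s IH /andP[xs us]; rewrite cat_uniq uF IH // andbT.
apply/hasPn => y /flatten_mapP[x' x's yx']; apply: contra xs => /= /gF <-.
by rewrite (gF _ _ yx').
Qed.

(** The argument b is the length of the second component, because the identity is summed over r; the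
    index i is the size of that component. *)
Definition keys (b a E : int) : seq (seq nat * seq nat) :=
  if (b, a, E) is (Posz b', Posz a', Posz e) then
    flatten [seq [seq (la, mu) | mu <- parts b' i, la <- parts a' (e - i)]
            | i <- index_iota 0 e.+1]
  else [::].

Lemma size_keys b a E : (size (keys b a E))%:R = pair_count b a E :> rat.
Proof.
case: b a E => b [] a [] e //; rewrite /keys /pair_count; congr (_%:R).
rewrite size_flatten /shape -map_comp sumnE big_map big_mkord.
by apply: eq_bigr => i _ /=; rewrite size_allpairs.
Qed.

Lemma mem_keys b a E k : (k \in keys b a E) =
  [&& sorted leq k.1, sorted leq k.2, (size k.2)%:Z == b, (size k.1)%:Z == a &
      (sumn k.1 + sumn k.2)%:Z == E].
Proof.
case: b a E => b [] a [] e;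
  try by rewrite in_nil /=; apply/esym/negbTE; rewrite !negb_and; lia.
rewrite /keys !eqz_nat; apply/flatten_mapP/idP => [[n]|].
  rewrite mem_index_iota ltnS => le_ne /allpairsP[[mu la]] /=; rewrite !mem_parts.
  case=> /and3P[/eqP smu omu /eqP emu] /and3P[/eqP sla ola /eqP ela] -> /=.
  by rewrite ola omu smu sla !eqxx /= ela emu subnK.
case/and5P => o1 o2 /eqP s2 /eqP s1 /eqP e12; exists (sumn k.2).
  by rewrite mem_index_iota ltnS -e12 leq_addl.
apply/allpairsP; exists (k.2, k.1); rewrite /= !mem_parts o1 o2 s1 s2 -e12 addnK !eqxx.
by split=> //; rewrite -surjective_pairing.
Qed.

Lemma uniq_keys b a E : uniq (keys b a E).
Proof.
case: b a E => b [] a [] e //; rewrite /keys.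
apply: (@uniq_flatten_sep _ _ _ _ (fun k => sumn k.2)) => [|i|i k]; first exact: iota_uniq.
  by apply: allpairs_uniq; rewrite ?uniq_parts // => -[? ?] [? ?] _ _ [-> ->].
by case/allpairsP => -[mu la] /= [+ _ ->]; rewrite mem_parts => /and3P[_ _ /eqP].
Qed.

Lemma qcoef_int u (n : int) : qcoef u n%:~R = if n is Posz k then u k else 0.
Proof.
rewrite /qcoef; case: n => n; first by rewrite -pmulrn natr_nat natrK.
by case: ifP => // /natr_ge0; rewrite ler0z.
Qed.

Lemma qcoef_nint u e : e \isn't a Num.int -> qcoef u e = 0.
Proof. by rewrite /qcoef; case: ifP => // /intr_nat->. Qed.

Lemma qcoef_inv (n : int) : qcoef inv_qpoch_inf n%:~R = part_count n.
Proof. by rewrite qcoef_int; case: n => // n; rewrite inv_qpoch_infE. Qed.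

Section Series.
Variables (L : rat) (M j : nat).
Hypotheses (LM : 2 * L = M%:R) (jM : (j = M %[mod 2])%Z).

Lemma chiL_val s r : (s <= M)%N ->
  chiL j L ((2 * s%:Z - M%:Z)%:~R ^+ 2 / 4 + r%:R) (2 * s%:Z - M%:Z) = (gauss M s)`_r.
Proof.
move=> le_sM; rewrite /chiL (_ : (_ == _ %[mod 2])%Z); last by move: jM; lia.
rewrite addrAC subrr add0r [qcoef _ _](qcoef_int _ r) LM.
rewrite (_ : M%:R = M%:~R) // intrKfloor.
rewrite (_ : L + _ = s%:~R) ?intrKfloor ?qbinomE //.
rewrite rmorphB rmorphM /=; move: LM; lra.
Qed.

Lemma chiL_neq0 d m : chiL j L d m != 0 -> exists s r,
  [/\ (s <= M)%N, (r < size (gauss M s))%N, m = 2 * s%:Z - M%:Z &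
      d = m%:~R ^+ 2 / 4 + r%:R].
Proof.
rewrite /chiL; case: ifP => // mj.
have [k ->] : exists k, m = 2 * k - M%:Z.
  exists ((m + M%:Z) %/ 2)%Z; move: mj jM; lia.
have -> : L + (2 * k - M%:Z)%:~R / 2 = k%:~R.
  by rewrite rmorphB rmorphM /=; move: LM; lra.
rewrite intrKfloor LM (_ : M%:R = M%:~R) // intrKfloor /qcoef.
case: ifP => // /natrP[r er]; rewrite er natrK => nz.
have [s es le_sM] : exists2 s : nat, k = s & (s <= M)%N.
  move: nz; rewrite /qbinom; case: ifP => [kM _|_]; last by rewrite coef0 eqxx.
  by exists `|k|%N; lia.
exists s, r; rewrite -es; split=> //; last by rewrite -er; ring.
rewrite ltnNge; apply: contra nz; rewrite es qbinomE // => le_r.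
by rewrite nth_default.
Qed.

Variables (i : nat).

(** The second factor has weight m' = 2s - M, and m'^2/4 - (m-m')^2/4 = -m^2/4 - mM/2 + ms. With q^r
    taken from the binomial, 1/(q)_oo must supply degree D + ms + r, which is the term of
    [gauss_sum] at -m. *)
Lemma qz_mul_durfee d m (D := - d - m%:~R ^+ 2 / 4 - m%:~R * M%:R / 2) :
  qz_mul (qz_invq (chi i)) (chiL j L) d m =
  if (m == (i + j)%N %[mod 2])%Z && (D \is a Num.int)
  then durfee_sum M (- m) (Num.floor D) else 0.
Proof.
pose term s r := (((2 * s%:Z - M%:Z)%:~R ^+ 2 / 4 + r%:R : rat), 2 * s%:Z - M%:Z).
pose supp := [seq term s r | s <- index_iota 0 M.+1, r <- index_iota 0 (size (gauss M s))].
rewrite /qz_mul (@fsbigE _ _ _ _ _ supp) //; last first.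
- move=> [d1 m1] _ /=; apply: contraNeq; rewrite mulf_eq0 negb_or => /andP[_].
  case/chiL_neq0 => s [r [sM rs -> ->]]; apply/allpairsPdep; exists s, r.
  by rewrite !mem_index_iota ltnS.
- apply: allpairs_uniq_dep => [|s _|]; rewrite ?iota_uniq //.
  move=> [s r] [s' r'] _ _ /= [e1 e2].
  have es : s = s' by lia.
  rewrite es in e1 *; move/addrI/eqP: e1; rewrite eqr_nat => /eqP->.
  by [].
rewrite (eq_bigl xpredT) => [|p]; last by rewrite classical_sets.mem_set.
rewrite big_allpairs_dep /=; rewrite big_mkord.
have termE s r : (s <= M)%N -> qz_invq (chi i) (d - (term s r).1) (m - (term s r).2)
    * chiL j L (term s r).1 (term s r).2 =
  if (m == (i + j)%N %[mod 2])%Z && (D \is a Num.int)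
  then (gauss M s)`_r * part_count (Num.floor D - - m * s%:Z + r%:Z) else 0.
  move=> sM; rewrite chiL_val // /qz_invq /chi.
  have -> : (m - (term s r).2 == i %[mod 2])%Z = (m == (i + j)%N %[mod 2])%Z.
    by move: jM => /=; lia.
  case: ifP => _; last by rewrite mul0r.
  have -> : - (d - (term s r).1) - (m - (term s r).2)%:~R ^+ 2 / 4 =
      D + (m * s%:Z + r%:Z)%:~R.
    by rewrite /D /= !(rmorphB, rmorphD, rmorphM) /=; field.
  case: ifP => [D_int|/negbT D_nint].
    rewrite -{1}(floorK D_int) -rmorphD qcoef_inv mulrC; congr (_ * part_count _); ring.
  by rewrite qcoef_nint ?mul0r // rpredDr // intr_int.
rewrite durfee_gauss /gauss_sum.
under eq_bigr => s _.
  rewrite big_mkord; under eq_bigr => r _.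
    rewrite termE; last by rewrite -ltnS.
  over.
over.
case: ifP => _; first by apply: eq_bigr.
by rewrite big1 // => s _; rewrite big1.
Qed.

End Series.

Section Count.
Variables (M p : nat) (L : rat).
Hypothesis LM : 2 * L = M%:R.

(** With r = b and weight m, l = b - m and N = 2b - m, so N^2/4 - NL = b(b - m - M) + m^2/4 + mM/2;
    D is what is left for b(b - m - M) plus the sizes of the partitions. *)
Definition key_list (d : rat) (m : int) : seq (seq nat * seq nat) :=
  let D := - d - m%:~R ^+ 2 / 4 - m%:~R * M%:R / 2 in
  if (m == p %[mod 2])%Z && (D \is a Num.int) then
    flatten [seq keys b%:Z (b%:Z - m) (Num.floor D - b%:Z * (b%:Z - m - M%:Z))
            | b <- index_iota 0 (durfee_bound M (- m) (Num.floor D))]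
  else [::].

Lemma size_key_list d m (D := - d - m%:~R ^+ 2 / 4 - m%:~R * M%:R / 2) :
  (size (key_list d m))%:R =
  if (m == p %[mod 2])%Z && (D \is a Num.int)
  then durfee_sum M (- m) (Num.floor D) else 0.
Proof.
rewrite /key_list -/D; case: ifP => // _.
rewrite size_flatten /shape -map_comp sumnE big_map natr_sum.
by apply: eq_bigr => b _; rewrite /= size_keys.
Qed.

Lemma uniq_key_list d m : uniq (key_list d m).
Proof.
rewrite /key_list; case: ifP => // _.
apply: (@uniq_flatten_sep _ _ _ _ (fun k => size k.2)) => [|b|b k].
- exact: iota_uniq.
- exact: uniq_keys.
- by rewrite mem_keys => /and5P[_ _ /eqP[]].
Qed.

Lemma mem_key_list d m k :
  (k \in key_list d m) = good_key p k && (key_bidegree L k == (d, m)).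
Proof.
have M_L : L = M%:R / 2 by move: LM; lra.
apply/idP/idP.
  rewrite /key_list; set D := - d - _ - _; case: ifP => // /andP[mp D_int].
  case/flatten_mapP => b _; rewrite mem_keys => /and5P[o1 o2 /eqP s2 /eqP s1 /eqP e12].
  have em : m = (size k.2)%:Z - (size k.1)%:Z by lia.
  rewrite /good_key o1 o2 /=; apply/andP; split.
    by move: mp; rewrite em; move: (size k.1) (size k.2) => x y; clear; lia.
  rewrite /key_bidegree; apply/eqP; congr (_, _); last by rewrite em PoszD; ring.
  have := congr1 (fun n : int => n%:~R : rat) e12.
  rewrite /= rmorphB /= (floorK D_int) !(rmorphM, rmorphB) /= -s2 em /D em.
  rewrite !(rmorphM, rmorphB) /= -!pmulrn M_L natrD => ->.
  by field.
case/andP => /and3P[o1 o2 kp] /eqP[ed em].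
have {}em : m = (size k.2)%:Z - (size k.1)%:Z by rewrite -em PoszD; ring.
rewrite /key_list; set D := - d - _ - _.
pose n : int := (sumn k.1 + sumn k.2)%:Z + (size k.2)%:Z * ((size k.1)%:Z - M%:Z).
have eD : D = n%:~R.
  rewrite /D -ed em /n PoszD !(rmorphM, rmorphB, rmorphD) /= -!pmulrn M_L ?natrD.
  by field.
rewrite eD intrKfloor (_ : n%:~R \is a Num.int) ?intr_int // andbT.
rewrite (_ : (m == p %[mod 2])%Z); last first.
  by move: kp; rewrite em; move: (size k.1) (size k.2) => x y; clear; lia.
have eE : n - (size k.2)%:Z * ((size k.2)%:Z - m - M%:Z) = (sumn k.1 + sumn k.2)%:Z.
  by rewrite /n em; ring.
apply/flatten_mapP; exists (size k.2).
  rewrite mem_index_iota /= ltnNge; apply/negP => /durfee_bound_lt.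
  by rewrite eE.
by rewrite mem_keys o1 o2 eqxx eE eqxx andbT /= em subKr.
Qed.

End Count.

Theorem proposition3p6 (R : realType) (L : rat) (i j : nat)
    (L_ge0 : 0 <= L) (L_half : 2 * L \is a Num.int)
    (i_lt2 : (i < 2)%N) (j_lt2 : (j < 2)%N)
    (jL : (j = Num.floor (2 * L) %[mod 2])%Z) :
  has_character (hatW_sum (complex R) L (i + j))
    (qz_mul (qz_invq (chi i)) (chiL j L)).
Proof.
have [M LM] : exists M : nat, 2 * L = M%:R.
  by apply/natrP; rewrite natrEint L_half mulr_ge0.
rewrite LM -[M%:R]/(M%:~R) intrKfloor in jL.
apply: (@hatW_sum_character (complex R) L (i + j) _ (key_list M (i + j))).
- exact: uniq_key_list.
- exact: mem_key_list.
- by move=> d m; rewrite (qz_mul_durfee LM jL) size_key_list.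
Qed.
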